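(* Let $\rho_0\in L^1(\mathbb{T})$ with $\rho_0\ge 0$ and let $u_0\in L^\infty(\mathbb{T})$. Let $\{\rho_{0,\epsilon}\}_{\epsilon\in(0,1]}$, $\{u_{0,\epsilon}\}_{\epsilon\in(0,1]}$ be families in $\mathcal{C}(\mathbb{T})$ such that $\rho_{0,\epsilon}(x)\ge\epsilon$ for all $x$, $\|\rho_0-\rho_{0,\epsilon}\|_{L^1(\mathbb{T})}\to 0$ and $\|u_{0,\epsilon}-u_0\|_{L^\infty(\mathbb{T})}\to 0$ as $\epsilon\to 0$. For each $\epsilon$ consider the system of ODEs in $\mathcal{C}(\mathbb{T})^2$, with unknowns $\rho>0$ and $\rho u$, $$\frac{d}{dt}\rho(x,t,\epsilon)=\frac1\epsilon\big[(\rho u^+)(x-\epsilon,t,\epsilon)-(\rho|u|)(x,t,\epsilon)+(\rho u^-)(x+\epsilon,t,\epsilon)\big],$$ $$\frac{d}{dt}(\rho u)(x,t,\epsilon)=\frac1\epsilon\big[(\rho u u^+)(x-\epsilon,t,\epsilon)-(\rho u|u|)(x,t,\epsilon)+(\rho u u^-)(x+\epsilon,t,\epsilon)\big],$$ $$u(x,t,\epsilon)=\frac{(\rho u)(x,t,\epsilon)}{\rho(x,t,\epsilon)},$$ with initial conditions $\rho(\cdot,0,\epsilon)=\rho_{0,\epsilon}$ and $(\rho u)(\cdot,0,\epsilon)=\rho_{0,\epsilon}u_{0,\epsilon}$. Then this system provides a weak asymptotic method of order $1$, global in space and in positive time, for the 1-D system of pressureless fluids $$\rho_t+(\rho u)_x=0,\qquad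 (\rho u)_t+(\rho u^2)_x=0 .$$ That is, the system of ODEs has for each $\epsilon$ a solution defined for all $t\in[0,+\infty)$, and for every $\psi\in\mathcal{C}_c^\infty(\mathbb{R})$ and every $t\in[0,+\infty)$, as $\epsilon\to0^+$, $$\int_{\mathbb{R}}\Big(\frac{d}{dt}\rho(x,t,\epsilon)\,\psi(x)-(\rho u)(x,t,\epsilon)\,\psi'(x)\Big)dx=O(\epsilon),$$ $$\int_{\mathbb{R}}\Big(\frac{d}{dt}(\rho u)(x,t,\epsilon)\,\psi(x)-(\rho u^2)(x,t,\epsilon)\,\psi'(x)\Big)dx=O(\epsilon).$$
   Context: $\mathbb{T}=\mathbb{R}/2\pi\mathbb{Z}$; functions on $\mathbb{T}$ are identified with $2\pi$-periodic functions on $\mathbb{R}$. $\mathcal{C}(\mathbb{T})$ is the Banach space of continuous real-valued functions on $\mathbb{T}$ with the sup norm. $u^+=\max(0,u)$ and $u^-=\max(0,-u)$, so $u=u^+-u^-$ and $|u|=u^++u^-$. A solution of the ODE system on $[0,+\infty)$ is a continuously differentiable map $t\mapsto(\rho(\cdot,t,\epsilon),(\rho u)(\cdot,t,\epsilon))$ from $[0,+\infty)$ (right-hand derivative at $t=0$) to $\mathcal{C}(\mathbb{T})^2$, with $\rho>0$. A weak asymptotic method for a system of PDEs is a family of functions, indexed by $\epsilon$ and differentiable in $t$, which satisfies the equations in the sense of distributions in the space variable, for each $t$, up to a remainder tending to $0$ as $\epsilon\to0^+$; it is of order $1$ if the remainder is $O(\epsilon)$ for each fixed test function. *)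

(* Defs.v *)
From mathcomp Require Import all_boot all_order all_algebra.
From mathcomp Require Import all_classical all_reals all_analysis.
Set Implicit Arguments.
Unset Strict Implicit.
Unset Printing Implicit Defensive.
Import Order.TTheory GRing.Theory Num.Theory.
Import numFieldNormedType.Exports.
Local Open Scope classical_set_scope.
Local Open Scope ring_scope.

(* Functions on the torus T = R / 2 pi Z are 2 pi-periodic functions on R; the
   Lebesgue measure of T is the one of R restricted to a fundamental domain. *)
Definition torus_measure (R : realType) :=
  mrestr (@lebesgue_measure R) (measurable_itv `[0, pi *+ 2[).

Definition LpT (R : realType) (p : \bar R) (f : R -> R) : Prop :=
  periodic f (pi *+ 2) /\ f \in Lfun (@torus_measure R) p.

Definition CT (R : realType) (f : R -> R) : Prop :=
  periodic f (pi *+ 2) /\ continuous f.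

(* F : [0, +oo[ -> C(T) is continuously differentiable with derivative DF.
   Convergence for the sup norm of C(T) is uniform convergence. Values of F at
   negative times are irrelevant, so the derivative at t = 0 is right-hand. *)
Definition C1_CT (R : realType) (F DF : R -> R -> R) : Prop :=
  forall t : R, 0 <= t ->
  [/\ CT (F t), CT (DF t),
      {uniform, (fun s => (fun x => (F s x - F t x) / (s - t)))
        @ within [set s | 0 <= s] t^' --> DF t} &
      {uniform, DF @ within [set s | 0 <= s] (nbhs t) --> DF t}].

(* Semi-discrete upwind right-hand side transporting the density w with velocity u;
   [f ^\+] and [f ^\-] are max(f, 0) and max(- f, 0). *)
Definition upwind (R : realType) (eps : R) (w u : R -> R) (x : R) : R :=
  eps^-1 * ((w \* u^\+) (x - eps) - w x * `|u x| + (w \* u^\-) (x + eps)).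

Definition velocity (R : realType) (rho m : R -> R -> R) (t x : R) : R :=
  m t x / rho t x.

(* [m] stands for the unknown rho u. *)
Record ode_solution (R : realType) (eps : R) (rho0 u0 : R -> R)
    (rho Drho m Dm : R -> R -> R) : Prop := OdeSolution {
  ode_rho_C1 : C1_CT rho Drho;
  ode_m_C1 : C1_CT m Dm;
  ode_rho_gt0 : forall t x, 0 <= t -> 0 < rho t x;
  ode_rho_eq : forall t x, 0 <= t ->
    Drho t x = upwind eps (rho t) (velocity rho m t) x;
  ode_m_eq : forall t x, 0 <= t ->
    Dm t x = upwind eps (m t) (velocity rho m t) x;
  ode_rho_init : forall x, rho 0 x = rho0 x;
  ode_m_init : forall x, m 0 x = rho0 x * u0 x }.

Definition test_function (R : realType) (psi : R -> R) : Prop :=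
  (forall n x, derivable (psi^`(n)%classic) x 1) /\
  compact (closure [set x | psi x != 0]).

(* Order-1 weak asymptotic method for w_t + flux_x = 0, where [Dw eps t x] is
   the time derivative of the approximation. *)
Definition weak_asymptotic_order1 (R : realType) (Dw flux : R -> R -> R -> R)
    : Prop :=
  forall psi : R -> R, test_function psi -> forall t : R, 0 <= t ->
  (fun eps : R => (\int[lebesgue_measure]_x
     (Dw eps t x * psi x - flux eps t x * psi^`()%classic x) : R))
  =O_ (0^'+) (fun eps : R => eps).

(* Main.v *)
Require Import Defs.
From mathcomp Require Import all_boot all_order all_algebra.
From mathcomp Require Import all_classical all_reals all_analysis.
From mathcomp Require Import measurable_realfun ess_sup_inf.
From mathcomp Require Import ring lra.
Import Order.TTheory GRing.Theory Num.Theory.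
Import numFieldNormedType.Exports.
Set Implicit Arguments.
Unset Strict Implicit.
Unset Printing Implicit Defensive.
Local Open Scope classical_set_scope.
Local Open Scope ring_scope.

(** Write m for rho u. Once the velocity u = m / rho is known, the scheme is
    linear in the transported density: rho and m both solve
    w_t = upwind eps w u, hence so do D+ = M rho + m and D- = M rho - m for
    any constant M. If |u| <= M and w >= 0, then upwind eps w u + (M / eps) w
    is nonnegative ([upwind_ge]): the only negative term of the scheme is the
    outflow w |u| / eps. Thus e^(M t / eps) D+ and e^(M t / eps) D- do not
    decrease as long as both are nonnegative, which is the condition |u| <= M:
    the cone |m| <= M rho is invariant.

    Existence. The pair z = e^(M t / eps) (D+, D-) solves an autonomous
    equation z' = field z, because u is unchanged when z is multiplied by a
    positive scalar. The vector field [field] maps nonnegative functions to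
    nonnegative functions, and there it is globally Lipschitz for the sup norm
    although u is a quotient: its terms have the form a b / s with
    0 <= a, b <= s ([frac_lip]). Hence the Picard iteration stays in the cone
    and converges for all times ([picard_exists]), and rho stays positive since
    z does not decrease. The iteration ignores the space variable; periodicity
    and continuity in x come from comparing the solution with its translates,
    which solve the same equation ([ode_exists]).

    Consistency. Now take any family of solutions. For small eps the initial
    velocities are bounded by one constant ([Linfty_near_bounded]), and so are
    the initial masses ([L1_near_bounded]). Invariance of the cone, proved by
    continuous induction in time ([momentum_le]), gives |u| <= M with M
    independent of eps, and the scheme conserves mass ([mass_conservation]).
    Against a test function psi, translations by eps and - eps are moved from
    the fluxes w u^+ and w u^- onto psi, and the difference quotients of psi
    differ from its derivative by at most eps sup |psi''|
    ([upwind_weak_estimate]). What remains is eps times the integral of |w u|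
    over the support of psi, which is controlled by the mass. *)

(** * Calculus on the real line *)

Section Calculus.
Context {R : realType}.
Implicit Types (f g F G : R -> R) (a b x t : R).

Lemma is_derive_continuous f (df : R -> R) :
  (forall t, is_derive t 1 f (df t)) -> continuous f.
Proof.
by move=> h t; apply/differentiable_continuous/derivable1_diffP; have [] := h t.
Qed.

Lemma continuous_fB f g : continuous f -> continuous g ->
  continuous (fun x => f x - g x).
Proof. by move=> cf cg x; apply: cvgB; [exact: cf|exact: cg]. Qed.

Lemma continuous_fD f g : continuous f -> continuous g ->
  continuous (fun x => f x + g x).
Proof. by move=> cf cg x; apply: cvgD; [exact: cf|exact: cg]. Qed.

Lemma continuous_fM f g : continuous f -> continuous g ->
  continuous (fun x => f x * g x).
Proof. by move=> cf cg x; apply: cvgM; [exact: cf|exact: cg]. Qed.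

Lemma continuous_fN f : continuous f -> continuous (fun x => - f x).
Proof. by move=> cf x; apply: cvgN; exact: cf. Qed.

Lemma continuous_translation f (h : R) : continuous f -> continuous (fun x => f (x + h)).
Proof.
move=> cf x; apply: continuous_comp; last exact: cf.
by apply: cvgD; [exact: cvg_id|exact: cvg_cst].
Qed.

Lemma continuous_funrpos f : continuous f -> continuous (f^\+).
Proof.
move=> cf x; apply: (@continuous_max _ _ f (cst 0)); first exact: cf.
exact: cvg_cst.
Qed.

Lemma continuous_funrneg f : continuous f -> continuous (f^\-).
Proof.
move=> cf; rewrite -funrposN; apply: continuous_funrpos => x.
by apply: cvgN; exact: cf.
Qed.

Lemma is_derive_expR_lin (k t : R) :
  is_derive t 1 (fun t => expR (k * t)) (k * expR (k * t)).
Proof.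
have dK : is_derive t (1 : R) (fun t : R => k * t) k.
  have := @is_deriveZ R R R id k t 1 1 (is_derive_id t (1 : R)).
  by rewrite /GRing.scale /= mulr1.
have := @is_derive1_comp _ (@expR R) _ t _ _ (is_derive_expR (k * t)) dK.
by rewrite mulrC.
Qed.

Lemma derive_le_increment f g (f' g' : R -> R) a b : a <= b ->
  continuous f -> continuous g ->
  (forall t, a < t < b -> is_derive t 1 f (f' t)) ->
  (forall t, a < t < b -> is_derive t 1 g (g' t)) ->
  (forall t, a < t < b -> f' t <= g' t) ->
  f b - f a <= g b - g a.
Proof.
rewrite le_eqVlt => /predU1P[->|ab]; first by rewrite !subrr.
move=> cf cg df dg fg.
have [t|t|c] := @MVT _ (g - f) (g' - f') a b ab.
- rewrite in_itv /= => tab.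
  by have := df _ tab; have := dg _ tab => ? ?; exact: is_deriveB.
- by apply: continuous_subspaceT => {}t; apply: continuousB; [exact: cg|exact: cf].
rewrite in_itv /= => /fg; rewrite !fctE -subr_ge0 => cab E.
have : 0 <= (g' c - f' c) * (b - a) by rewrite mulr_ge0 // subr_ge0 ltW.
rewrite -E; lra.
Qed.

(** In the Picard iteration below, g is an exponential, the weight of the norm. *)
Lemma normr_derive_le_increment f g (f' g' : R -> R) a b : a <= b ->
  continuous f -> continuous g ->
  (forall t, a < t < b -> is_derive t 1 f (f' t)) ->
  (forall t, a < t < b -> is_derive t 1 g (g' t)) ->
  (forall t, a < t < b -> `|f' t| <= g' t) ->
  `|f b - f a| <= g b - g a.
Proof.
move=> ab cf cg df dg fg; rewrite ler_norml; apply/andP; split; last first.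
  apply: (derive_le_increment ab cf cg df dg) => t tab.
  exact: le_trans (ler_norm _) (fg _ tab).
have dNg t : a < t < b -> is_derive t 1 (- g) (- g' t).
  by move=> /dg ?; exact: is_deriveN.
have cNg : continuous (- g) by move=> t; apply: continuousN; exact: cg.
have := derive_le_increment ab cNg cf dNg df.
rewrite !fctE => h; rewrite (le_trans _ (h _)) ?opprB //; last first.
  by move=> t /fg; rewrite ler_norml => /andP[].
by rewrite opprK addrC.
Qed.

Lemma primitive_right f A : continuous f ->
  exists F, F 0 = 0 /\ forall t, - A < t -> is_derive t 1 F (f t).
Proof.
move=> cf.
pose G x := (\int[lebesgue_measure]_(t in `[- A, x]) f t)%R.
exists (fun x => G x - G 0); split; first by rewrite subrr.
move=> t At.
have cfs : {within `[- A, t + 1], continuous f} by exact: continuous_subspaceT.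
have := @continuous_FTC1_closed _ f (- A) t (t + 1).
rewrite ltrDl ltr01 => /(_ isT) h.
have [] := h _ At (cf t).
  by apply: continuous_compact_integrable cfs; exact: segment_compact.
move=> d1 d2.
rewrite -[f t]subr0; apply: is_deriveB.
by rewrite -d2 derive1E; exact: derivableP.
Qed.

(** A primitive on the whole line is obtained by gluing at 0 a primitive on a
   right half-line with the reflection of a primitive of the reflected function. *)
Lemma primitive f : continuous f ->
  exists F, F 0 = 0 /\ forall t, is_derive t 1 F (f t).
Proof.
move=> cf; have [P [P0 dP]] := primitive_right 1 cf.
have cg : continuous (fun t => - f (- t)).
  move=> t; apply: continuousN; apply: continuous_comp; last exact: cf.
  exact: oppr_continuous.
have [Q [Q0 dQ]] := primitive_right 1 cg.
pose N t := Q (- t).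
have dN t : t < 1 -> is_derive t 1 N (f t).
  move=> t1; have := dQ (- t); rewrite ltrN2 opprK => /(_ t1) d1.
  have := @is_derive1_comp _ Q -%R t _ _ d1 (is_deriveN (is_derive_id _ _)).
  by rewrite mulrN1 opprK.
have N0 : N 0 = 0 by rewrite /N oppr0.
have NP t : -1 < t < 1 -> P t = N t.
  pose D : R -> R := P - N.
  move=> /andP[t1 t2].
  have dD (s : R) : -1 < s < 1 -> is_derive s 1 D 0.
    move=> /andP[s1 s2]; rewrite -(subrr (f s)).
    by have := dP _ s1; have := dN _ s2 => ? ?; exact: is_deriveB.
  have wD (u v : R) : -1 < u -> v < 1 -> {within `[u, v], continuous D}.
    move=> u1 v1; apply: derivable_within_continuous => s.
    rewrite in_itv /= => /andP[us sv].
    by have [] : is_derive s 1 D 0 by apply: dD; rewrite (lt_le_trans u1 us) (le_lt_trans sv v1).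
  suff : D t = 0 by rewrite /D !fctE => /subr0_eq.
  have D0 : D 0 = 0 by rewrite /D !fctE P0 N0 subrr.
  have [t0|t0] := leP 0 t.
    have w : {within `[0, t], continuous D} by apply: wD => //; lra.
    have [s|c _] := MVT_segment (df := cst 0) t0 _ w.
      by rewrite in_itv /= => /andP[? ?]; apply: dD; apply/andP; split; lra.
    by rewrite D0 /= mul0r subr0.
  have w : {within `[t, 0], continuous D} by apply: wD => //; lra.
  have [s|c _] := MVT_segment (df := cst 0) (ltW t0) _ w.
    by rewrite in_itv /= => /andP[? ?]; apply: dD; apply/andP; split; lra.
  by rewrite D0 /= mul0r => /eqP; rewrite sub0r oppr_eq0 => /eqP.
exists (fun t => if 0 <= t then P t else N t); rewrite lexx; split => // t.
have [t0|t0] := leP 0 t.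
  apply: (@near_eq_is_derive _ _ _ P); last by apply: dP; lra.
  have t1 : -1 < t by lra.
  near=> s; have [//|s0] := leP 0 s.
  apply: NP; apply/andP; split; last lra.
  by near: s; exact: lt_nbhsr.
apply: (@near_eq_is_derive _ _ _ N); last by apply: dN; lra.
near=> s; have [s0|//] := leP 0 s.
have : s < 0 by near: s; exact: lt_nbhsl.
by rewrite ltNge s0.
Unshelve. all: by end_near. Qed.

Lemma mean_value f df : (forall x, is_derive x 1 f (df x)) ->
  forall x (h : R), exists2 c, `|c - x| <= `|h| & f (x + h) - f x = df c * h.
Proof.
move=> dfE x h; have cf (a b : R) : {within `[a, b], continuous f}.
  by apply: continuous_subspaceT; exact: is_derive_continuous dfE.
have [h0|h0] := leP 0 h.
  have xh : x <= x + h by rewrite lerDl.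
  have [c] := MVT_segment xh (fun c _ => dfE c) (cf _ _).
  rewrite in_itv /= => /andP[xc ch] ->; exists c; last by rewrite addrAC subrr add0r.
  by rewrite (ger0_norm h0) ler_norml; apply/andP; split; lra.
have xh : x + h <= x by rewrite gerDl ltW.
have [c] := MVT_segment xh (fun c _ => dfE c) (cf _ _).
rewrite in_itv /= => /andP[xc ch] E; exists c; last by rewrite -opprB E; ring.
by rewrite (ltr0_norm h0) ler_norml; apply/andP; split; lra.
Qed.

Lemma taylor1 f df ddf (B : R) : (forall x, is_derive x 1 f (df x)) ->
  (forall x, is_derive x 1 df (ddf x)) -> (forall x, `|ddf x| <= B) ->
  forall x (h : R), `|f (x + h) - f x - h * df x| <= B * h ^+ 2.
Proof.
move=> dfE ddfE hB x h; have [c xc ->] := mean_value dfE x h.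
have [c' _] := mean_value ddfE x (c - x); rewrite (addrC x) subrK => E.
have -> : df c * h - h * df x = (df c - df x) * h by ring.
rewrite E normrM normrM -real_normK ?num_real // expr2 mulrA.
by apply: ler_wpM2r => //; apply: ler_pM.
Qed.

Definition itg a b f : R := \int[lebesgue_measure]_(x in `[a, b]) f x.

Lemma itgE f F a b : a <= b -> continuous f ->
  (forall t, is_derive t 1 F (f t)) -> itg a b f = F b - F a.
Proof.
rewrite le_eqVlt => /predU1P[->|ab] cf dF.
  by rewrite /itg set_itv1 Rintegral_set1 subrr.
rewrite /itg /Rintegral (@continuous_FTC2 _ f F a b ab) //.
- exact: continuous_subspaceT.
- split.
  + by move=> t _; have [] := dF t.
  + by apply: cvg_at_right_filter; exact: (is_derive_continuous dF).
  + by apply: cvg_at_left_filter; exact: (is_derive_continuous dF).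
- by move=> t _; rewrite derive1E; apply: derive_val.
Qed.

Lemma itg_integrable f a b : continuous f ->
  lebesgue_measure.-integrable `[a, b] (EFin \o f).
Proof.
move=> cf; apply: continuous_compact_integrable; first exact: segment_compact.
exact: continuous_subspaceT.
Qed.

Lemma itg_le f g a b : continuous f -> continuous g ->
  (forall x, a <= x <= b -> f x <= g x) -> itg a b f <= itg a b g.
Proof.
move=> cf cg fg; apply: le_Rintegral => //; exact: itg_integrable.
Qed.

Lemma itg_norm f a b : continuous f -> `|itg a b f| <= itg a b (fun x => `|f x|).
Proof. by move=> cf; apply: le_normr_Rintegral => //; exact: itg_integrable. Qed.

Lemma itgB f g a b : continuous f -> continuous g ->
  itg a b (f - g) = itg a b f - itg a b g.
Proof.
by move=> cf cg; rewrite /itg -RintegralB //; exact: itg_integrable.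
Qed.

Lemma itgD f g a b : continuous f -> continuous g ->
  itg a b (f + g) = itg a b f + itg a b g.
Proof.
by move=> cf cg; rewrite /itg -RintegralD //; exact: itg_integrable.
Qed.

Lemma itgZ (k : R) f a b : continuous f ->
  itg a b (fun x => k * f x) = k * itg a b f.
Proof.
by move=> cf; rewrite /itg -RintegralZl //; exact: itg_integrable.
Qed.

Lemma itg_cst (k : R) a b : a <= b -> itg a b (cst k) = k * (b - a).
Proof.
move=> ab; have dF (t : R) : is_derive t (1 : R) (fun x : R => k * x) k.
  have := @is_deriveZ R R R id k t 1 1 (is_derive_id t (1 : R)).
  by rewrite /GRing.scale /= mulr1.
by rewrite (itgE ab _ dF) ?mulrBr // => ?; exact: cvg_cst.
Qed.

Lemma itg_shift f a b h : a <= b -> continuous f ->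
  itg a b (fun x => f (x + h)) = itg (a + h) (b + h) f.
Proof.
move=> ab cf; have [F [_ dF]] := primitive cf.
rewrite (itgE _ cf dF) ?lerD2r //.
apply: (@itgE (fun x => f (x + h)) (fun x => F (x + h)) a b ab) => [x|t].
  apply: continuous_comp; last exact: cf.
  by apply: cvgD; [exact: cvg_id|exact: cvg_cst].
have d1 : is_derive t (1 : R) (fun x : R => x + h) (1 : R).
  by rewrite -[X in is_derive _ _ _ X]addr0; apply: is_deriveD.
by have := @is_derive1_comp _ F _ t _ _ (dF (t + h)) d1; rewrite mulr1.
Qed.

Lemma itg_cat f a b c : a <= b -> b <= c -> continuous f ->
  itg a c f = itg a b f + itg b c f.
Proof.
move=> ab bc cf; have [F [_ dF]] := primitive cf.
rewrite !(itgE _ cf dF) ?(le_trans ab bc) //; lra.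
Qed.

(** The derivative of the left-hand side in h is f (h + T) - f h = 0. *)
Lemma itg_period f T h : 0 <= T -> continuous f -> periodic f T ->
  itg h (h + T) f = itg 0 T f.
Proof.
move=> T0 cf pf; have [F [_ dF]] := primitive cf.
rewrite !(itgE _ cf dF) ?lerDl //.
have dG t : is_derive t 1 (fun t => F (t + T) - F t) 0.
  rewrite -[0](subrr (f t)); apply: is_deriveB.
  have d1 : is_derive t (1 : R) (fun x : R => x + T) (1 : R).
    by rewrite -[X in is_derive _ _ _ X]addr0; apply: is_deriveD.
  have := @is_derive1_comp _ F _ t _ _ (dF (t + T)) d1.
  by rewrite mulr1 pf.
by have := is_derive_0_is_cst h 0 dG; rewrite add0r.
Qed.

Lemma itg_periods (f : R -> R) (T : R) n : 0 <= T -> continuous f -> periodic f T ->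
  itg (- (T *+ n)) (T *+ n) f = itg 0 T f *+ (n + n).
Proof.
move=> T0 cf pf.
have half k : itg 0 (T *+ k) f = itg 0 T f *+ k.
  elim: k => [|k IH]; first by rewrite !mulr0n /itg set_itv1 Rintegral_set1.
  rewrite (itg_cat (b := T *+ k)) ?mulrn_wge0 // ?lerMn2r //; last first.
    by rewrite mulrS lerDr.
  by rewrite IH [T *+ k.+1]mulrSr itg_period // -mulrSr.
have pn : periodic f (T *+ n) by move=> x; exact: periodicn.
have Tn0 : 0 <= T *+ n by rewrite mulrn_wge0.
have left_half := @itg_period f (T *+ n) (- (T *+ n)) Tn0 cf pn.
rewrite addNr in left_half.
by rewrite (itg_cat (b := 0)) ?oppr_le0 // left_half half mulrnDr.
Qed.

Lemma itg_supp f a b : (forall x, ~ (a <= x <= b) -> f x = 0) ->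
  (\int[lebesgue_measure]_x f x)%R = itg a b f.
Proof.
move=> h; rewrite /itg [RHS]Rintegral_mkcond; apply: eq_Rintegral => x _.
rewrite patchE; case: ifPn => //; rewrite notin_setE /= in_itv /= => xab.
exact: h.
Qed.

Lemma continuous_bounded f a b : continuous f ->
  exists2 C, 0 <= C & forall x, a <= x <= b -> `|f x| <= C.
Proof.
move=> cf; have [ab|ab] := leP a b; last first.
  by exists 0 => // x xab; exfalso; lra.
have cn : {within `[a, b], continuous (fun x => `|f x|)}.
  apply: continuous_subspaceT => x; apply: continuous_comp; first exact: cf.
  exact: norm_continuous.
have [c _ hc] := EVT_max ab cn.
by exists `|f c| => // x xab; apply: hc; rewrite in_itv.
Qed.

(** Heine-Cantor, for translations: a compact segment has the covering property
    that makes a local bound on the shift h uniform. *)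
Lemma continuous_unif f a b : continuous f -> forall e : R, 0 < e ->
  \forall h \near 0, forall x, a <= x <= b -> `|f (x + h) - f x| < e.
Proof.
move=> cf e e0.
have /compact_near_coveringP := @segment_compact _ a b.
move=> /(_ R (nbhs 0) (fun h x => `|f (x + h) - f x| < e) _) H.
have : \forall h \near 0, [set` `[a, b]] `<=` (fun x => `|f (x + h) - f x| < e).
  apply: H => x _.
  have e2 : 0 < e / 2 by lra.
  have /cvgrPdist_lt /(_ _ e2) /nbhs_ballP[d /= d0 hd] := cf x.
  have {}hd y : `|x - y| < d -> `|f x - f y| < e / 2 by move=> xy; exact: hd.
  have d2 : 0 < d / 2 by lra.
  near=> y h.
  have xy : `|x - y| < d / 2 by near: y; exact: nbhsx_ballx.
  have h0 : `|0 - h| < d / 2 by near: h; exact: nbhsx_ballx.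
  move: xy h0; rewrite sub0r normrN !ltr_norml => /andP[? ?] /andP[? ?].
  have /andP[? ?] : - (e / 2) < f x - f y < e / 2.
    by rewrite -ltr_norml; apply: hd; rewrite ltr_norml; apply/andP; split; lra.
  have /andP[? ?] : - (e / 2) < f x - f (y + h) < e / 2.
    by rewrite -ltr_norml; apply: hd; rewrite ltr_norml; apply/andP; split; lra.
  by apply/andP; split; lra.
by apply: filterS => h hh x xab; apply: hh; rewrite /= in_itv.
Unshelve. all: by end_near. Qed.

(** Continuous induction: P holds before the infimum of its failures, hence at
    this infimum, hence beyond it. *)
Lemma real_induction (P : R -> Prop) :
  (forall T : R, 0 <= T -> (forall s, 0 <= s < T -> P s) -> P T) ->
  (forall T : R, 0 <= T -> P T -> \forall s \near T, 0 <= s -> P s) ->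
  forall t, 0 <= t -> P t.
Proof.
move=> H1 H2 t t0; apply: contrapT => nP.
pose S : set R := [set s | 0 <= s /\ ~ P s].
have lbS : has_lbound S by exists 0 => s [].
have neS : S !=set0 by exists t.
have infS : has_inf S := conj neS lbS.
have T0 : 0 <= inf S by apply: lb_le_inf => // s [].
have below s : 0 <= s < inf S -> P s.
  move=> /andP[s0 sS]; apply: contrapT => nPs.
  have : inf S <= s by apply: ge_inf.
  by rewrite leNgt sS.
have /nbhs_ballP[d /= d0 hd] := H2 _ T0 (H1 _ T0 below).
have [s [s0 nPs] sd] := inf_adherent d0 infS.
have Ss : inf S <= s by exact: (ge_inf lbS (conj s0 nPs)).
apply: nPs; apply: hd => //; rewrite /ball /= ltr_norml.
by apply/andP; split; lra.
Qed.

End Calculus.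

(** * Picard iteration in the nonnegative cone *)

Section Picard.
Context {R : realType}.
Implicit Types (s t : R).

Lemma le_of_le_geometric (a b c : R) :
  (forall n, a <= b + c * (2 ^+ n)^-1) -> a <= b.
Proof.
move=> h; rewrite leNgt; apply/negP => ba.
pose n := (Num.truncn (c / (a - b))).+1.
have n2 : c / (a - b) < 2 ^+ n.
  apply: lt_trans (truncnS_gt _) _.
  by rewrite -natrX ltr_nat ltn_expl.
have := h n; rewrite leNgt => /negP; apply.
have d0 : 0 < a - b by lra.
suff : c * (2 ^+ n)^-1 < a - b by lra.
by rewrite ltr_pdivrMr ?exprn_gt0 // mulrC -ltr_pdivrMr.
Qed.

(** The intervals of radius 2 c / 2 ^ n around u n are nested; l is the supremum
    of their left ends. *)
Lemma geometric_cauchy (u : nat -> R) (c : R) :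
  (forall n, `|u n.+1 - u n| <= c * (2 ^+ n)^-1) ->
  exists l, forall n, `|u n - l| <= 2 * c * (2 ^+ n)^-1.
Proof.
move=> h.
pose r n := 2 * c * (2 ^+ n)^-1.
have rS n : r n.+1 = r n / 2.
  by rewrite /r exprS invfM; ring.
have hr n : `|u n.+1 - u n| <= r n / 2.
  by apply: le_trans (h n) _; rewrite le_eqVlt; apply/orP; left; apply/eqP; rewrite /r; field.
have r0 n : 0 <= r n by have := le_trans (normr_ge0 _) (hr n); lra.
pose a n := u n - r n; pose b n := u n + r n.
have aS n : a n <= a n.+1.
  by have := hr n; rewrite ler_norml /a rS => /andP[]; lra.
have bS n : b n.+1 <= b n.
  by have := hr n; rewrite ler_norml /b rS => /andP[]; lra.
have aD n k : a n <= a (n + k)%N.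
  by elim: k => [|k IH]; rewrite ?addn0 // addnS (le_trans IH).
have bD n k : b (n + k)%N <= b n.
  by elim: k => [|k IH]; rewrite ?addn0 // addnS (le_trans _ IH).
have ab n m : a n <= b m.
  have := aD n m; have := bD m n; rewrite addnC /a /b.
  by have := r0 (n + m)%N; lra.
pose S := range a.
have S0 : S !=set0 by exists (a 0%N); exists 0%N.
exists (sup S) => n.
have up : a n <= sup S.
  by apply: ub_le_sup; [exists (b n) => _ [k _ <-]|exists n].
have lo : sup S <= b n by apply: ge_sup => // _ [k _ <-].
by rewrite ler_norml; move: up lo; rewrite /a /b /r => ? ?; apply/andP; split; lra.
Qed.

(** A total function, so that the Picard iteration is one too; only its value at
    a continuous f matters. *)
Definition prim (f : R -> R) : R -> R :=
  if pselect (continuous f) is left cf then projT1 (cid (primitive cf)) else f.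

Lemma primP (f : R -> R) : continuous f ->
  prim f 0 = 0 /\ forall t, is_derive t 1 (prim f) (f t).
Proof.
by move=> cf; rewrite /prim; case: pselect => // cf'; case: cid.
Qed.

(* The equation is y' = G y for functions on an index set X without structure,
   in the sup norm. Positivity of G keeps the iteration in the only region where
   G is assumed to be Lipschitz. *)
Context {X : Type} (G : (X -> R) -> X -> R) (L C : R) (y0 : X -> R).
Hypothesis L0 : 0 <= L.
Hypothesis C0 : 0 <= C.
Hypothesis y0_ge0 : forall x, 0 <= y0 x.
Hypothesis Gy0 : forall x, `|G y0 x| <= C.
Hypothesis G_ge0 : forall f : X -> R, (forall x, 0 <= f x) -> forall x, 0 <= G f x.
Hypothesis G_lip : forall (f g : X -> R) (c : R),
  (forall x, 0 <= f x) -> (forall x, 0 <= g x) ->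
  (forall x, `|f x - g x| <= c) -> forall x, `|G f x - G g x| <= L * c.

(* K >= 2 L makes the Picard map a contraction of ratio 1 / 2 on the whole
   half-line, for the sup norm weighted by 1 / E. The added 1 makes K positive
   and leaves room for the constant C when L = 0. *)
Let K := 2 * L + 1.
Let E t := expR (K * t).

Let K0 : 0 < K. Proof. by have := L0; rewrite /K; lra. Qed.

Let E_gt0 t : 0 < E t. Proof. exact: expR_gt0. Qed.

Let E0 : E 0 = 1. Proof. by rewrite /E mulr0 expR0. Qed.

Let le_E s t : s <= t -> E s <= E t.
Proof. by move=> st; rewrite /E ler_expR ler_pM2l. Qed.

Let E_ge1 t : 0 <= t -> 1 <= E t.
Proof. by move=> t0; rewrite -E0; exact: le_E. Qed.

Let dE c t : is_derive t 1 (fun t => c * E t) (c * (K * E t)).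
Proof.
exact: (@is_deriveZ R R R E c t 1 _ (is_derive_expR_lin K t)).
Qed.

Let cE c : continuous (fun t => c * E t).
Proof. exact: (is_derive_continuous (dE c)). Qed.

(* The second condition keeps y in the cone; the third one is a modulus of
   continuity in time, uniform in x, so that t |-> G (y t) x is continuous. *)
Let admissible (y : R -> X -> R) :=
  [/\ forall x, y 0 x = y0 x,
      forall t x, 0 <= t -> y0 x <= y t x &
      forall s t x, 0 <= s -> s <= t -> `|y t x - y s x| <= C * E t - C * E s].

Let adm_ge0 y t x : admissible y -> 0 <= t -> 0 <= y t x.
Proof. by move=> [_ h _] t0; exact: le_trans (y0_ge0 x) (h _ _ t0). Qed.

Let adm_cont y x : admissible y -> continuous (fun t => G (y `|t|) x).
Proof.
move=> ay t.
have cn : (fun s => L * (C * E `|s|)) @ t --> L * (C * E `|t|).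
  apply: cvgM; first exact: cvg_cst.
  apply: (@cvg_comp _ _ _ _ (fun t => C * E t) _ (nbhs `|t|)); last exact: cE.
  exact: norm_continuous.
apply/cvgrPdist_le => e e0; move/cvgrPdist_le : cn => /(_ _ e0).
apply: filterS => s; apply: le_trans.
have -> : `|L * (C * E `|t|) - L * (C * E `|s|)| =
          L * `|C * E `|t| - C * E `|s| |.
  by rewrite -mulrBr normrM (ger0_norm L0).
apply: G_lip => x'; try exact: adm_ge0.
have [_ _ h] := ay.
have [ts|st] := leP `|t| `|s|.
  rewrite distrC (le_trans (h _ _ x' _ ts)) //.
  by rewrite distrC ler_norm.
by rewrite (le_trans (h _ _ x' _ (ltW st))) // ler_norm.
Qed.

(* Only times t >= 0 matter; reflecting time at 0 makes the integrand continuous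
   on the whole line. *)
Let picard (y : R -> X -> R) t x := y0 x + prim (fun s => G (y `|s|) x) t.

Let picard_d y x t : admissible y ->
  is_derive t 1 (fun t => picard y t x) (G (y `|t|) x).
Proof.
move=> ay; have [_ d] := primP (@adm_cont y x ay).
rewrite -[G _ _]add0r; apply: is_deriveD; exact: d.
Qed.

Let picard_c y x : admissible y -> continuous (fun t => picard y t x).
Proof. by move=> ay; apply: is_derive_continuous => t; exact: picard_d. Qed.

Let picard_0 y x : admissible y -> picard y 0 x = y0 x.
Proof.
by move=> ay; have [h _] := primP (@adm_cont y x ay); rewrite /picard h addr0.
Qed.

Let adm_G y t x : admissible y -> 0 <= t -> `|G (y t) x| <= C * (K * E t).
Proof.
move=> ay t0.
have : `|G (y t) x - G y0 x| <= L * (C * E t - C * E 0).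
  apply: G_lip => // x'; first exact: adm_ge0.
  by have [h _ h'] := ay; rewrite -h; exact: h'.
rewrite E0 mulr1 => h.
have -> : G (y t) x = (G (y t) x - G y0 x) + G y0 x by rewrite subrK.
apply: le_trans (ler_normD _ _) _.
apply: le_trans (lerD h (Gy0 x)) _.
rewrite -subr_ge0.
have -> : C * (K * E t) - (L * (C * E t - C) + C) =
  C * (L * E t + L + (E t - 1)) by rewrite /K; ring.
apply: mulr_ge0 => //; have LE : 0 <= L * E t by rewrite mulr_ge0 // ltW.
by have := E_ge1 t0; have := L0; lra.
Qed.

Let picard_adm y : admissible y -> admissible (picard y).
Proof.
move=> ay; split => [x|t x t0|s t x s0 st].
- exact: picard_0.
- rewrite -subr_ge0 -(@picard_0 y x ay).
  have := @derive_le_increment _ (cst 0) (fun t => picard y t x) (cst 0)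
    (fun t => G (y `|t|) x) 0 t t0.
  rewrite /= subrr; apply => //.
  + by move=> ?; exact: cvg_cst.
  + exact: picard_c.
  + by move=> ? _; exact: picard_d.
  + by move=> u _; apply: G_ge0 => x'; exact: adm_ge0.
- apply: (@normr_derive_le_increment _ (fun t => picard y t x) (fun t => C * E t)
    (fun t => G (y `|t|) x) (fun t => C * (K * E t)) s t st) => //.
  + exact: picard_c.
  + by move=> ? _; exact: picard_d.
  + move=> u /andP[su _]; have u0 : 0 <= u by lra.
    by rewrite (ger0_norm u0); exact: adm_G.
Qed.

Let contraction y z c : admissible y -> admissible z -> 0 <= c ->
  (forall t x, 0 <= t -> `|y t x - z t x| <= c * E t) ->
  forall t x, 0 <= t -> `|picard y t x - picard z t x| <= c / 2 * E t.
Proof.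
move=> ay az c0 h t x t0.
have := @normr_derive_le_increment _ (fun t => picard y t x - picard z t x)
  (fun t => c / 2 * E t) (fun t => G (y `|t|) x - G (z `|t|) x)
    (fun t => c / 2 * (K * E t)) 0 t t0.
rewrite !picard_0 // E0 subrr subr0 => H.
suff : `|picard y t x - picard z t x| <= c / 2 * E t - c / 2 * 1 by lra.
apply: H => //.
- by move=> u; apply: cvgB; exact: picard_c.
- by move=> u _; apply: is_deriveB; exact: picard_d.
- move=> u /andP[u0 _].
  have -> : `|u| = u by rewrite ger0_norm // ltW.
  have := @G_lip (y u) (z u) (c * E u) _ _ _ x.
  move=> /(_ _ _ _) H1; apply: le_trans (H1 _ _ _) _ => [x'|x'|x'|].
  + by apply: adm_ge0 => //; exact: ltW.
  + by apply: adm_ge0 => //; exact: ltW.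
  + by apply: h; exact: ltW.
  rewrite -subr_ge0.
  have -> : c / 2 * (K * E u) - L * (c * E u) = c / 2 * E u by rewrite /K; field.
  by rewrite mulr_ge0 ?divr_ge0 // ltW.
Qed.

Let Y n := iter n picard (fun _ => y0).

Let Y_adm n : admissible (Y n).
Proof.
elim: n => [|n IH]; last exact: picard_adm.
split => // s t x s0 st; rewrite subrr normr0 -mulrBr mulr_ge0 // subr_ge0.
exact: le_E.
Qed.

Let Y_step n t x : 0 <= t -> `|Y n.+1 t x - Y n t x| <= C * (2 ^+ n)^-1 * E t.
Proof.
elim: n t x => [|n IH] t x t0.
  rewrite expr0 invr1 mulr1.
  have [h _ h'] := Y_adm 1.
  by have := h' 0 t x (lexx _) t0; rewrite h E0 => /le_trans; apply; have := C0; lra.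
have -> : C * (2 ^+ n.+1)^-1 = C * (2 ^+ n)^-1 / 2 by rewrite exprS invfM; ring.
apply: contraction => //; first exact: (Y_adm n.+1).
by rewrite mulr_ge0 // invr_ge0 exprn_ge0.
Qed.

Let limit : exists y, forall n t x, 0 <= t ->
  `|Y n t x - y t x| <= 2 * C * E t * (2 ^+ n)^-1.
Proof.
have /choice[y hy] : forall tx : R * X, exists l, 0 <= tx.1 -> forall n,
    `|Y n tx.1 tx.2 - l| <= 2 * (C * E tx.1) * (2 ^+ n)^-1.
  move=> [t x] /=; have [t0|t0] := leP 0 t; last by exists 0.
  have [|l hl] := @geometric_cauchy (fun n => Y n t x) (C * E t).
    by move=> n; rewrite mulrAC; exact: Y_step.
  by exists l.
exists (fun t x => y (t, x)) => n t x t0.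
by have := hy (t, x) t0 n; rewrite /= !mulrA.
Qed.

(** The last clause is obtained by comparing the iterates with their reindexings
    by a symmetry phi of G. It is the source of all regularity in x: with phi a
    translation, it bounds the oscillation of the solution by that of y0. *)
Theorem picard_exists : exists y : R -> X -> R,
  [/\ forall x, y 0 x = y0 x,
      forall t x, 0 <= t -> y0 x <= y t x,
      forall t x, 0 <= t -> is_derive t 1 (fun t => y t x) (G (y t) x),
      forall s t x, 0 <= s -> s <= t -> `|y t x - y s x| <= C * E t - C * E s &
      forall phi : X -> X, (forall f x, G (f \o phi) x = G f (phi x)) ->
        forall w, (forall x, `|y0 (phi x) - y0 x| <= w) ->
        forall t x, 0 <= t -> `|y t (phi x) - y t x| <= w * E t].
Proof.
have [y hy] := limit.
have ay : admissible y.
  split => [x|t x t0|s t x s0 st].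
  - apply/eqP; rewrite -subr_eq0 -normr_le0.
    apply: (@le_of_le_geometric _ _ (2 * C * E 0)) => n.
    have := hy n 0 x (lexx _); have [-> _ _] := Y_adm n.
    by rewrite distrC add0r.
  - apply: (@le_of_le_geometric _ _ (2 * C * E t)) => n.
    have := hy n t x t0; have [_ /(_ t x t0) + _] := Y_adm n.
    by rewrite ler_norml => ? /andP[? ?]; lra.
  - have t0 := le_trans s0 st.
    apply: (@le_of_le_geometric _ _ (2 * C * E t + 2 * C * E s)) => n.
    have := hy n t x t0; have := hy n s x s0; have [_ _ h] := Y_adm n.
    have {h} := h s t x s0 st.
    rewrite mulrDl !ler_norml => /andP[? ?] /andP[? ?] /andP[? ?].
    by apply/andP; split; lra.
have fixy t x : 0 <= t -> picard y t x = y t x.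
  move=> t0; apply/eqP; rewrite -subr_eq0 -normr_le0.
  apply: (@le_of_le_geometric _ _ (2 * C * E t)) => n.
  have e0 : 0 <= 2 * C * (2 ^+ n)^-1.
    by rewrite mulr_ge0 ?mulr_ge0 // invr_ge0 exprn_ge0.
  have H1 : `|picard (Y n) t x - picard y t x| <= 2 * C * (2 ^+ n)^-1 / 2 * E t.
    apply: contraction => // u x' u0.
    by rewrite mulrAC; exact: hy.
  have := hy n.+1 t x t0; rewrite [Y n.+1]/= -/(Y n).
  have -> : 2 * C * E t * (2 ^+ n.+1)^-1 = 2 * C * (2 ^+ n)^-1 / 2 * E t.
    by rewrite exprS invfM; field; rewrite expf_neq0 //; lra.
  move: H1; rewrite !ler_norml => /andP[? ?] /andP[? ?].
  have -> : 0 + 2 * C * E t * (2 ^+ n)^-1 = 2 * C * (2 ^+ n)^-1 * E t by ring.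
  by apply/andP; split; lra.
(* The limit y satisfies the integral equation at times t >= 0 only; its image by
   the Picard map agrees with it there and is differentiable at 0 as well. *)
exists (picard y); split.
- by have [] := picard_adm ay.
- by have [] := picard_adm ay.
- move=> t x t0; have := @picard_d y x t ay; rewrite ger0_norm //.
  suff -> : y t = picard y t by [].
  by apply/funext => x'; rewrite fixy.
- by have [] := picard_adm ay.
- move=> phi Gphi w hw t x t0; rewrite !fixy //.
  have w0 : 0 <= w by exact: le_trans (normr_ge0 _) (hw x).
  have H n : forall t x, 0 <= t -> `|Y n t (phi x) - Y n t x| <= w * E t.
    clear t x t0; elim: n => [|n IH] t x t0.
      apply: le_trans (hw x) _.
      by rewrite -{1}[w]mulr1 ler_wpM2l // E_ge1.
    have := @normr_derive_le_increment _
      (fun t => Y n.+1 t (phi x) - Y n.+1 t x) (fun t => w * E t)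
      (fun t => G (Y n `|t|) (phi x) - G (Y n `|t|) x)
      (fun t => w * (K * E t)) 0 t t0.
    have [Y0 _ _] := Y_adm n.+1; rewrite !Y0 E0 => HH.
    set D := Y n.+1 t (phi x) - Y n.+1 t x in HH *.
    suff : `|D - (y0 (phi x) - y0 x)| <= w * E t - w * 1.
      have := hw x; rewrite !ler_norml => /andP[? ?] /andP[? ?].
      by apply/andP; split; lra.
    apply: HH => //.
    + by move=> u; apply: cvgB; exact: picard_c.
    + by move=> u _; apply: is_deriveB; exact: picard_d.
    + move=> u /andP[u0 _].
      have -> : `|u| = u by rewrite ger0_norm // ltW.
      rewrite -Gphi.
      apply: (@le_trans _ _ (L * (w * E u))).
        apply: G_lip => x' /=.
        * by apply: adm_ge0 => //; exact: ltW.
        * by apply: adm_ge0 => //; exact: ltW.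
        * by apply: IH; exact: ltW.
      rewrite -subr_ge0.
      have -> : w * (K * E u) - L * (w * E u) = w * E u * (L + 1) by rewrite /K; ring.
      by rewrite !mulr_ge0 ?addr_ge0 // ltW.
  apply: (@le_of_le_geometric _ _ (2 * C * E t + 2 * C * E t)) => n.
  have := H n t x t0; have := hy n t x t0; have := hy n t (phi x) t0.
  rewrite mulrDl !ler_norml => /andP[? ?] /andP[? ?] /andP[? ?].
  by apply/andP; split; lra.
Qed.

End Picard.

(** * Functions on the torus and the upwind operator *)

Section Torus.
Context {R : realType}.
Implicit Types (f g u w : R -> R) (s t x h : R).

Lemma uniform_cvgP (F : set_system R) (FF : Filter F) (g : R -> R -> R) f :
  {uniform, g @ F --> f} <->
  forall e : R, 0 < e -> \forall s \near F, forall x, `|f x - g s x| < e.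
Proof.
split => [h e e0|h P /uniform_nbhs[E [entE EP]]].
  have := h [set k | forall x, `|f x - k x| < e]; apply.
  apply/uniform_nbhs; exists [set xy | ball xy.1 e xy.2]; split.
    exact: entourage_ball (PosNum e0).
  by move=> k hk x; exact: (hk x).
have [e /= e0 eE] : exists2 e : R, 0 < e & [set xy | ball xy.1 e xy.2] `<=` E.
  by move: entE; rewrite -entourage_ballE => -[e e0 eE]; exists e.
have := h e e0; apply: filterS => s hs; apply: EP => x _; apply: eE; exact: hs.
Qed.

Lemma periodic_intmul f T : periodic f T -> forall (k : int) x, f (x + T *~ k) = f x.
Proof.
move=> pf [n|n] x; first exact: periodicn.
by rewrite NegzE mulrNz -[LHS](periodicn pf n.+1) pmulrn subrK.
Qed.

Lemma periodic_reduce f T : 0 < T -> periodic f T ->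
  forall x, exists2 y, 0 <= y <= T & forall h, f (x + h) = f (y + h).
Proof.
move=> T0 pf x; pose k := Num.floor (x / T).
exists (x - T *~ k) => [|h].
  have := floor_le (x / T); have := floorD1_gt (x / T).
  rewrite -/k ltr_pdivrMr // ler_pdivlMr // -mulrzr rmorphD /=.
  by move=> ? ?; apply/andP; split; lra.
by rewrite -[RHS](periodic_intmul pf k) addrAC subrK.
Qed.

Lemma twopi_gt0 : 0 < pi *+ 2 :> R.
Proof. by rewrite mulr2n addr_gt0 // pi_gt0. Qed.

Lemma CT_bounded f : CT f -> exists2 B, 0 <= B & forall x, `|f x| <= B.
Proof.
move=> [pf cf]; have [B B0 hB] := continuous_bounded 0 (pi *+ 2) cf.
exists B => // x; have [y yI hy] := periodic_reduce twopi_gt0 pf x.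
by have := hy 0; rewrite !addr0 => ->; exact: hB.
Qed.

Lemma CT_unif f : CT f -> forall e : R, 0 < e ->
  \forall h \near 0, forall x, `|f (x + h) - f x| < e.
Proof.
move=> [pf cf] e e0; have := @continuous_unif _ _ 0 (pi *+ 2) cf e e0.
apply: filterS => h hh x; have [y yI hy] := periodic_reduce twopi_gt0 pf x.
by have := hy 0; rewrite !addr0 hy => ->; exact: hh.
Qed.

Lemma CT_lin (a b : R) f g : CT f -> CT g -> CT (fun x => a * f x + b * g x).
Proof.
move=> [pf cf] [pg cg]; split => [x|x]; first by rewrite pf pg.
by apply: cvgD; apply: cvgM; (try exact: cvg_cst); [exact: cf|exact: cg].
Qed.

Lemma CT_div f g : CT f -> CT g -> (forall x, g x != 0) -> CT (fun x => f x / g x).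
Proof.
move=> [pf cf] [pg cg] g0; split => [x|x]; first by rewrite pf pg.
by apply: cvgM; [exact: cf|apply: cvgV => //; exact: cg].
Qed.

Lemma max0E (a : R) : Num.max a 0 = (a + `|a|) / 2.
Proof.
have [a0|a0] := leP a 0; first by rewrite ler0_norm // subrr mul0r.
by rewrite gtr0_norm //; field.
Qed.

Lemma max_split (v : R) : Num.max v 0 + Num.max (- v) 0 = `|v|.
Proof. by rewrite !max0E normrN; field. Qed.

Lemma continuous_wpos (w u : R -> R) : continuous w -> continuous u ->
  continuous (w \* u^\+).
Proof.
by move=> cw cu x; apply: cvgM; [exact: cw|exact: continuous_funrpos].
Qed.

Lemma continuous_wneg (w u : R -> R) : continuous w -> continuous u ->
  continuous (w \* u^\-).
Proof.
by move=> cw cu x; apply: cvgM; [exact: cw|exact: continuous_funrneg].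
Qed.

Lemma CT_upwind (eps : R) w u : CT w -> CT u -> CT (upwind eps w u).
Proof.
move=> [pw cw] [pu cu]; split => [x|].
  rewrite /upwind /= /funrpos /funrneg.
  rewrite [x + _ - eps]addrAC [x + _ + eps]addrAC.
  by rewrite !pw !pu.
have cwp := continuous_wpos cw cu; have cwn := continuous_wneg cw cu.
have cwa : continuous (fun x => w x * `|u x|).
  by move=> x; apply: cvgM; [exact: cw|apply: cvg_norm; exact: cu].
move=> x; apply: cvgM; first exact: cvg_cst.
apply: cvgD; last exact: (continuous_translation cwn).
by apply: cvgB; [exact: (continuous_translation cwp)|exact: cwa].
Qed.

Lemma upwind_lin (eps a b : R) f g u x :
  upwind eps (fun y => a * f y + b * g y) u x =
  a * upwind eps f u x + b * upwind eps g u x.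
Proof. by rewrite /upwind /=; ring. Qed.

(** The outflow w x * |u x| / eps is the only negative term of the scheme. *)
Lemma upwind_ge (eps M : R) (w u : R -> R) x : 0 < eps ->
  (forall y, 0 <= w y) -> `|u x| <= M -> 0 <= M / eps * w x + upwind eps w u x.
Proof.
move=> eps0 w0 uM.
have -> : M / eps * w x + upwind eps w u x = eps^-1 *
  ((w \* u^\+) (x - eps) + (M - `|u x|) * w x + (w \* u^\-) (x + eps)).
  by rewrite /upwind /=; ring.
have max0 (a : R) : 0 <= Num.max a 0 by rewrite le_max lexx orbT.
by rewrite mulr_ge0 ?invr_ge0 ?(ltW eps0) // !addr_ge0 //= ?mulr_ge0 // subr_ge0.
Qed.

(** The conservative form: differences of the right-going and of the left-going
    flux. *)
Lemma upwindE (eps : R) (w u : R -> R) x : upwind eps w u x =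
  eps^-1 * (((w \* u^\+) (x - eps) - (w \* u^\+) x) -
            ((w \* u^\-) x - (w \* u^\-) (x + eps))).
Proof.
by rewrite /upwind -(max_split (u x)) /funrpos /funrneg /=; ring.
Qed.

Lemma itg_upwind (eps : R) (w u : R -> R) : CT w -> CT u ->
  itg 0 (pi *+ 2) (upwind eps w u) = 0.
Proof.
move=> [pw cw] [pu cu].
have T0 := ltW twopi_gt0.
pose P : R -> R := w \* u^\+; pose N : R -> R := w \* u^\-.
have cP : continuous P by exact: continuous_wpos.
have cN : continuous N by exact: continuous_wneg.
have pP : periodic P (pi *+ 2) by move=> x; rewrite /P /funrpos /= pw pu.
have pN : periodic N (pi *+ 2) by move=> x; rewrite /N /funrneg /= pw pu.
have sh (f : R -> R) h : continuous f -> periodic f (pi *+ 2) ->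
    itg 0 (pi *+ 2) (fun x => f (x + h)) = itg 0 (pi *+ 2) f.
  by move=> cf pf; rewrite itg_shift // add0r addrC itg_period.
pose A : R -> R := fun x => P (x - eps) - P x.
pose B : R -> R := fun x => N x - N (x + eps).
have cA : continuous A.
  exact: (continuous_fB (@continuous_translation R P (- eps) cP) cP).
have cB : continuous B.
  exact: (continuous_fB cN (@continuous_translation R N eps cN)).
have -> : upwind eps w u = (fun x => eps^-1 * (A - B) x).
  by apply/funext => x; rewrite upwindE.
rewrite itgZ; last by move=> x; apply: cvgB; [exact: cA|exact: cB].
rewrite itgB //.
have -> : itg 0 (pi *+ 2) A = 0.
  rewrite -[A]/((fun x => P (x - eps)) - P) itgB //; last exact: continuous_translation.
  by rewrite sh // subrr.
have -> : itg 0 (pi *+ 2) B = 0.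
  rewrite -[B]/(N - (fun x => N (x + eps))) itgB //; last exact: continuous_translation.
  by rewrite sh // subrr.
by rewrite subrr mulr0.
Qed.

End Torus.

(** * The scheme as a Lipschitz vector field *)

Section Field.
Context {R : realType}.

(** The function a b / s is homogeneous of degree one, and the ratios a / s and
    b / s lie in [0, 1], which bounds its gradient. At s = 0 also a = b = 0, and
    the convention 1 / 0 = 0 gives the continuous extension. *)
Lemma frac_lip (a b s a' b' s' : R) :
  0 <= a <= s -> 0 <= b <= s -> 0 <= a' <= s' -> 0 <= b' <= s' ->
  `|a * b / s - a' * b' / s'| <= `|a - a'| + `|b - b'| + `|s - s'|.
Proof.
have ratio (c r : R) : 0 <= c <= r -> 0 <= c / r <= 1 /\ c = c / r * r.
  move=> /andP[c0 cr]; have [r0|r0] := eqVneq r 0.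
    by move: cr; rewrite r0 invr0 !mulr0 => ?; split; lra.
  have rp : 0 < r by rewrite lt_neqAle eq_sym r0 (le_trans c0 cr).
  rewrite (divr_ge0 c0 (ltW rp)) /= ler_pdivrMr // mul1r cr; split => //.
  by rewrite divfK.
move=> /ratio[+ Ea] /ratio[+ Eb] /ratio[+ Ea'] /ratio[+ Eb'].
rewrite (mulrAC a) (mulrAC a').
move: (a / s) (b / s) (a' / s') (b' / s') Ea Eb Ea' Eb'.
move=> al be al' be' Ea Eb Ea' Eb' /andP[? ?] /andP[? ?] /andP[? ?] /andP[? ?].
have -> : al * b - al' * b' = al * (b - b') + be' * (a - a') + al * be' * (s' - s).
  by rewrite Ea Eb Ea' Eb'; ring.
have N (k z : R) : 0 <= k -> k <= 1 -> `|k * z| <= `|z|.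
  by move=> k0 k1; rewrite normrM (ger0_norm k0) ler_piMl.
have p0 : 0 <= al * be' by rewrite mulr_ge0.
have p1 : al * be' <= 1 by rewrite mulr_ile1.
apply: le_trans (ler_normD _ _) _; rewrite (distrC s).
apply: lerD; last exact: N.
apply: le_trans (ler_normD _ _) _; rewrite addrC.
by apply: lerD; exact: N.
Qed.

Lemma max0_lip (a b : R) : `|Num.max a 0 - Num.max b 0| <= `|a - b|.
Proof.
by case: (leP a 0) => ?; case: (leP b 0) => ?; rewrite !ler_norml;
  have := ler_norm (a - b); have := ler_norm (b - a); rewrite (distrC b);
  move=> ? ?; apply/andP; split; lra.
Qed.

Context (eps M : R).
Hypotheses (eps0 : 0 < eps) (M0 : 0 < M).
Implicit Types (f g : bool * R -> R) (c x : R) (b : bool).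

(** Up to a common positive factor, f (true, x) and f (false, x) stand for
    M rho + m and M rho - m, so that vel f is the velocity m / rho. *)
Definition vel f x := M * (f (true, x) - f (false, x)) / (f (true, x) + f (false, x)).

(** The term M / eps * f comes from multiplying the solution by e^(M t / eps). *)
Definition field f (bx : bool * R) :=
  upwind eps (fun y => f (bx.1, y)) (vel f) bx.2 + M / eps * f bx.

Lemma vel_le f : (forall z, 0 <= f z) -> forall x, `|vel f x| <= M.
Proof.
move=> f0 x; rewrite /vel; set p := f _; set q := f _.
have p0 : 0 <= p by exact: f0.
have q0 : 0 <= q by exact: f0.
have [z0|z0] := eqVneq (p + q) 0; first by rewrite z0 invr0 mulr0 normr0 ltW.
have s0 : 0 < p + q by rewrite lt_neqAle eq_sym z0 addr_ge0.
rewrite normrM normfV (gtr0_norm s0) ler_pdivrMr // normrM (gtr0_norm M0).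
by rewrite ler_pM2l // ler_norml; apply/andP; split; lra.
Qed.

Let fluxp f b x := f (b, x) * Num.max (vel f x) 0.
Let fluxn f b x := f (b, x) * Num.max (- vel f x) 0.

Let fieldE f b x : field f (b, x) = eps^-1 *
  (fluxp f b (x - eps) - (fluxp f b x + fluxn f b x) + fluxn f b (x + eps) +
   M * f (b, x)).
Proof.
rewrite /field /upwind /fluxp /fluxn /funrpos /funrneg /= -mulrDr.
rewrite max_split.
by rewrite [in RHS]mulrDr [M / eps]mulrC mulrA.
Qed.

Lemma field_ge0 f : (forall z, 0 <= f z) -> forall z, 0 <= field f z.
Proof.
move=> f0 [b x]; rewrite /field addrC.
by apply: upwind_ge => //; exact: vel_le.
Qed.

(** The flux w u^+ is M a b / s with a = w, b = (p - q)^+ and s = p + q; exchanging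
    p and q gives w u^-. The constant 5 is 1 + 2 + 2. *)
Lemma flux_lip (p q w p' q' w' c : R) :
  0 <= p -> 0 <= q -> 0 <= p' -> 0 <= q' ->
  0 <= w <= p + q -> 0 <= w' <= p' + q' ->
  `|p - p'| <= c -> `|q - q'| <= c -> `|w - w'| <= c ->
  `|w * Num.max (M * (p - q) / (p + q)) 0 -
    w' * Num.max (M * (p' - q') / (p' + q')) 0| <= 5 * M * c.
Proof.
move=> p0 q0 p0' q0' wI wI' hp hq hw.
have E (u v z : R) : 0 <= u -> 0 <= v ->
    z * Num.max (M * (u - v) / (u + v)) 0 = M * (z * Num.max (u - v) 0 / (u + v)).
  move=> u0 v0; have r0 : 0 <= M / (u + v) by rewrite divr_ge0 ?addr_ge0 // ltW.
  have -> : Num.max (M * (u - v) / (u + v)) 0 = M / (u + v) * Num.max (u - v) 0.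
    by rewrite maxr_pMr // mulr0; congr Num.max; rewrite mulrAC.
  by rewrite mulrCA mulrA; ring.
have B (u v : R) : 0 <= u -> 0 <= v -> 0 <= Num.max (u - v) 0 <= u + v.
  by move=> u0 v0; rewrite le_max lexx orbT /= ge_max; apply/andP; split; lra.
have -> : 5 * M * c = M * (5 * c) by ring.
rewrite !E // -mulrBr normrM (gtr0_norm M0) ler_pM2l //.
apply: le_trans (frac_lip wI (B _ _ p0 q0) wI' (B _ _ p0' q0')) _.
have h1 : `|Num.max (p - q) 0 - Num.max (p' - q') 0| <= 2 * c.
  apply: le_trans (max0_lip _ _) _.
  move: hp hq; rewrite !ler_norml => /andP[? ?] /andP[? ?].
  by apply/andP; split; lra.
have h2 : `|p + q - (p' + q')| <= 2 * c.
  move: hp hq; rewrite !ler_norml => /andP[? ?] /andP[? ?].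
  by apply/andP; split; lra.
lra.
Qed.

(** Four fluxes with Lipschitz constant 5 M, and M f. *)
Lemma field_lip f g c : (forall z, 0 <= f z) -> (forall z, 0 <= g z) ->
  (forall z, `|f z - g z| <= c) ->
  forall z, `|field f z - field g z| <= 21 * M / eps * c.
Proof.
move=> f0 g0 fg [b x].
have le_sum (h : bool * R -> R) y : (forall z, 0 <= h z) ->
    0 <= h (b, y) <= h (true, y) + h (false, y).
  move=> h0; rewrite h0 /=.
  by case: b; [have := h0 (false, y)|have := h0 (true, y)]; lra.
have P y : `|fluxp f b y - fluxp g b y| <= 5 * M * c.
  by apply: flux_lip => //; exact: le_sum.
have N y : `|fluxn f b y - fluxn g b y| <= 5 * M * c.
  have E (h : bool * R -> R) : - vel h y =
      M * (h (false, y) - h (true, y)) / (h (false, y) + h (true, y)).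
    by rewrite /vel [h (true, y) + h _]addrC -mulNr -mulrN opprB.
  rewrite /fluxn !E; apply: flux_lip => //.
    by rewrite addrC; exact: le_sum.
  by rewrite addrC; exact: le_sum.
have Z : `|M * f (b, x) - M * g (b, x)| <= M * c.
  by rewrite -mulrBr normrM (gtr0_norm M0) ler_pM2l.
have -> : 21 * M / eps * c = eps^-1 * (21 * M * c) by ring.
rewrite !fieldE -mulrBr normrM gtr0_norm ?invr_gt0 // ler_pM2l ?invr_gt0 //.
move: Z (P (x - eps)) (P x) (N x) (N (x + eps)).
rewrite !ler_norml => /andP[? ?] /andP[? ?] /andP[? ?] /andP[? ?] /andP[? ?].
by apply/andP; split; lra.
Qed.

Lemma field_shift (h : R) f z :
  field (f \o (fun z => (z.1, z.2 + h))) z = field f (z.1, z.2 + h).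
Proof.
case: z => b x; rewrite /field /upwind /vel /funrpos /funrneg /=.
by rewrite [x + h - eps]addrAC [x + h + eps]addrAC.
Qed.

End Field.

(** * Existence of global solutions *)

Section Existence.
Context {R : realType}.
Implicit Types (s t x h : R) (F DF H : R -> R -> R).

(** Continuity of H as a map from [0, +oo[ to functions with the sup norm. *)
Definition time_unif H := forall t, 0 <= t -> forall e : R, 0 < e ->
  \forall s \near t, 0 <= s -> forall x, `|H t x - H s x| < e.

(** By the mean value theorem, difference quotients are values of DF at
    intermediate times, so that pointwise differentiability suffices. *)
Lemma C1_CT_intro F DF :
  (forall t, 0 <= t -> CT (F t)) -> (forall t, 0 <= t -> CT (DF t)) ->
  (forall t x, 0 <= t -> is_derive t 1 (fun t => F t x) (DF t x)) ->
  time_unif DF -> C1_CT F DF.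
Proof.
move=> cF cDF dF uDF t t0; split; [exact: cF|exact: cDF| |].
- apply/uniform_cvgP => e e0.
  have /nbhs_ballP[d /= d0 hd] := uDF t t0 e e0.
  suff : nbhs t (fun s => s != t -> 0 <= s ->
    forall x, `|DF t x - (F s x - F t x) / (s - t)| < e) by [].
  apply/nbhs_ballP; exists d => //= s ts st s0 x.
  have mean a b : 0 <= a -> a < b ->
      exists2 c, a <= c <= b & F b x - F a x = DF c x * (b - a).
    move=> a0 ab; have [c||c] := @MVT R (fun t => F t x) (fun t => DF t x) a b ab.
    - by rewrite in_itv /= => /andP[ac _]; apply: dF; rewrite (le_trans a0) // ltW.
    - apply: derivable_within_continuous => c; rewrite in_itv /= => /andP[ac _].
      by have [] := dF c x (le_trans a0 ac).
    - rewrite in_itv /= => /andP[ac cb] E; exists c => //.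
      by apply/andP; split; exact: ltW.
  have [c] : exists2 c, 0 <= c /\ `|t - c| < d & (F s x - F t x) / (s - t) = DF c x.
    move: ts; rewrite /ball /= ltr_norml => /andP[ts1 ts2].
    have [lt|lt|eq] := ltgtP s t; last by rewrite eq eqxx in st.
      have [c /andP[c1 c2] E] := mean s t s0 lt; exists c.
        by split; [lra|rewrite ltr_norml; apply/andP; split; lra].
      rewrite -opprB E -mulrN opprB mulfK //; lra.
    have [c /andP[c1 c2] E] := mean t s t0 lt; exists c.
      by split; [lra|rewrite ltr_norml; apply/andP; split; lra].
    rewrite E mulfK //; lra.
  by move=> [c0 tc] ->; exact: hd.
- by apply/uniform_cvgP => e e0; exact: (uDF t t0 e e0).
Qed.

Lemma time_unif_lin (a b : R) F H : time_unif F -> time_unif H ->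
  time_unif (fun t x => a * F t x + b * H t x).
Proof.
move=> uF uH t t0 e e0.
have k0 : 0 < `|a| + `|b| + 1 by rewrite ltr_wpDl // addr_ge0.
have e1 : 0 < e / (`|a| + `|b| + 1) by rewrite divr_gt0.
have := uH t t0 _ e1; apply: filterS2 (uF t t0 _ e1) => s hF hH s0 x.
have -> : a * F t x + b * H t x - (a * F s x + b * H s x) =
  a * (F t x - F s x) + b * (H t x - H s x) by ring.
apply: le_lt_trans (ler_normD _ _) _; rewrite !normrM.
have h1 := ler_wpM2l (normr_ge0 a) (ltW (hF s0 x)).
have h2 := ler_wpM2l (normr_ge0 b) (ltW (hH s0 x)).
have -> : e = (`|a| + `|b| + 1) * (e / (`|a| + `|b| + 1)).
  by rewrite mulrC divfK // gt_eqF.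
rewrite !mulrDl mul1r; lra.
Qed.

(** The modulus r propagates the bound on H 0 to a bound on each H t, which the
    product needs. *)
Lemma time_unif_mul (k : R -> R) (r : R -> R) H :
  continuous k -> continuous r ->
  (forall s t x, 0 <= s -> 0 <= t -> `|H t x - H s x| <= `|r t - r s|) ->
  (exists B, forall x, `|H 0 x| <= B) ->
  time_unif (fun t x => k t * H t x).
Proof.
move=> ck cr lipH [B hB] t t0 e e0.
pose Bt := B + `|r t - r 0|.
have hBt x : `|H t x| <= Bt.
  have -> : H t x = H 0 x + (H t x - H 0 x) by rewrite addrC subrK.
  by apply: le_trans (ler_normD _ _) _; apply: lerD => //; exact: lipH.
have cb : (fun s => `|k s| * `|r t - r s| + `|k t - k s| * Bt) @ t --> (0 : R).
  have -> : (0 : R) = `|k t| * `|r t - r t| + `|k t - k t| * Bt.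
    by rewrite !subrr normr0 mulr0 mul0r addr0.
  apply: cvgD; apply: cvgM.
  - by apply: cvg_norm; exact: ck.
  - by apply: cvg_norm; apply: cvgB; [exact: cvg_cst|exact: cr].
  - by apply: cvg_norm; apply: cvgB; [exact: cvg_cst|exact: ck].
  - exact: cvg_cst.
move/cvgrPdist_lt : cb => /(_ e e0); apply: filterS => s hs s0 x.
apply: le_lt_trans hs; rewrite sub0r normrN.
apply: le_trans (ler_norm _).
have -> : k t * H t x - k s * H s x = k s * (H t x - H s x) + (k t - k s) * H t x.
  by ring.
apply: le_trans (ler_normD _ _) _; rewrite !normrM.
by apply: lerD; apply: ler_wpM2l => //; exact: lipH.
Qed.

(** The solution z of z' = field z from z = (M rho0 + m0, M rho0 - m0) is
    multiplied by e^(- M t / eps), which leaves the velocity unchanged and removes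
    the term M / eps * z. The choice M > sup |u0| makes the initial z positive. *)
Theorem ode_exists (eps : R) (rho0 u0 : R -> R) : 0 < eps ->
  CT rho0 -> CT u0 -> (forall x, 0 < rho0 x) ->
  exists rho Drho m Dm : R -> R -> R, ode_solution eps rho0 u0 rho Drho m Dm.
Proof.
move=> eps0 crho0 cu0 rho0_gt0.
have [M0 M00 hM0] := CT_bounded cu0.
pose M := M0 + 1.
have Mgt0 : 0 < M by rewrite /M; lra.
pose sg (b : bool) : R := if b then 1 else -1.
pose y0 (z : bool * R) := M * rho0 z.2 + sg z.1 * (rho0 z.2 * u0 z.2).
have cm0 : CT (fun x => rho0 x * u0 x).
  split => [x|x]; first by rewrite crho0.1 cu0.1.
  by apply: cvgM; [exact: crho0.2|exact: cu0.2].
have cy0 b : CT (fun x => y0 (b, x)) by exact: CT_lin.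
have y0_gt0 z : 0 < y0 z.
  case: z => b x; rewrite /y0 /=.
  have -> : M * rho0 x + sg b * (rho0 x * u0 x) = rho0 x * (M + sg b * u0 x) by ring.
  rewrite mulr_gt0 // /sg; have := hM0 x; rewrite ler_norml /M => /andP[? ?].
  by case: b; lra.
have [B B0 hB] : exists2 B, 0 <= B & forall z, `|y0 z| <= B.
  have [B1 B10 h1] := CT_bounded (cy0 true).
  have [B2 B20 h2] := CT_bounded (cy0 false).
  exists (B1 + B2); first by rewrite addr_ge0.
  by move=> [[] x]; [have := h1 x|have := h2 x] => /le_trans; apply; lra.
pose G := field eps M; pose L := 21 * M / eps; pose l := M / eps.
have L0 : 0 <= L by rewrite divr_ge0 ?mulr_ge0 // ltW.
have G0 : forall z, G (fun _ => 0) z = 0.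
  by move=> z; rewrite /G /field /upwind /=; ring.
have Gy0 z : `|G y0 z| <= L * B.
  rewrite -[G y0 z]subr0 -(G0 z).
  apply: field_lip => // [z'|z']; first exact: ltW.
  by rewrite subr0.
have [y [yi yge dy lipy shy]] := picard_exists L0 (mulr_ge0 L0 B0)
  (fun z => ltW (y0_gt0 z)) Gy0 (field_ge0 eps0 Mgt0) (field_lip eps0 Mgt0).
pose K := 2 * L + 1.
have y_gt0 t z : 0 <= t -> 0 < y t z.
  by move=> t0; apply: lt_le_trans (y0_gt0 z) (yge _ _ t0).
pose E t := expR (- l * t).
have E_gt0 t : 0 < E t by exact: expR_gt0.
have dE t : is_derive t 1 E (- l * E t) by exact: is_derive_expR_lin.
have cE : continuous E by exact: is_derive_continuous dE.
pose gl t z := G (y t) z - l * y t z.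
have glE t b x : gl t (b, x) = upwind eps (fun x => y t (b, x)) (vel M (y t)) x.
  by rewrite /gl /G /field /= addrK.
pose w b t x := E t * y t (b, x).
pose Dw b t x := E t * gl t (b, x).
have dw b t x : 0 <= t -> is_derive t 1 (fun t => w b t x) (Dw b t x).
  move=> t0; have d2 := dy t (b, x) t0.
  have := @is_deriveM R R E (fun t => y t (b, x)) t 1 _ _ (dE t) d2.
  rewrite /GRing.scale /= => d.
  have -> : Dw b t x = E t * field eps M (y t) (b, x) + y t (b, x) * (- l * E t).
    by rewrite /Dw /gl /G; ring.
  exact: d.
(* Translation by 2 pi leaves y0 unchanged and a small translation moves it
   uniformly little; both facts pass to the solution. *)
have cy b t : 0 <= t -> CT (fun x => y t (b, x)).
  move=> t0.
  have sh h (om : R) : (forall z, `|y0 (z.1, z.2 + h) - y0 z| <= om) ->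
      forall x, `|y t (b, x + h) - y t (b, x)| <= om * expR (K * t).
    move=> hom x; apply: (shy (fun z => (z.1, z.2 + h)) _ om hom t (b, x) t0).
    by move=> f z; exact: field_shift.
  split => [x|x].
    apply/eqP; rewrite -subr_eq0 -normr_le0 -(mul0r (expR (K * t))).
    by apply: sh => -[b' z] /=; rewrite (cy0 b').1 subrr normr0.
  apply/cvgrPdist_lt => e e0.
  pose om := e / 2 / expR (K * t).
  have om0 : 0 < om by rewrite !divr_gt0 ?expR_gt0.
  have /nbhs_ballP[d1 /= d10 hd1] := CT_unif (cy0 true) om0.
  have /nbhs_ballP[d2 /= d20 hd2] := CT_unif (cy0 false) om0.
  apply/nbhs_ballP; exists (Num.min d1 d2); first by rewrite /= lt_min d10.
  move=> x' /=; rewrite /ball /= lt_min => /andP[x1 x2].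
  have : `|y t (b, x + (x' - x)) - y t (b, x)| <= om * expR (K * t).
    apply: sh => -[[] z] /=; apply: ltW.
      by apply: hd1; rewrite /ball /= sub0r opprB.
    by apply: hd2; rewrite /ball /= sub0r opprB.
  rewrite (addrC x) subrK distrC => /le_lt_trans; apply.
  by rewrite /om divfK ?gt_eqF ?expR_gt0 //; lra.
have uDw b : time_unif (Dw b).
  pose r t := (L + l) * (L * B * expR (K * t)).
  have cr : continuous r.
    move=> t; apply: cvgM; first exact: cvg_cst.
    apply: cvgM; first exact: cvg_cst.
    apply: continuous_comp; last exact: continuous_expR.
    by apply: cvgM; [exact: cvg_cst|exact: cvg_id].
  have l0 : 0 <= l by rewrite divr_ge0 // ltW.
  have lip s t z : 0 <= s -> s <= t -> `|gl t z - gl s z| <= r t - r s.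
    move=> s0 st; have t0 := le_trans s0 st.
    have h1 : `|G (y t) z - G (y s) z| <=
        L * (L * B * expR (K * t) - L * B * expR (K * s)).
      apply: field_lip => // z'; try exact: ltW (y_gt0 _ _ _).
      exact: lipy.
    have := ler_wpM2l l0 (lipy s t z s0 st).
    rewrite -{1}(ger0_norm l0) -normrM => h2.
    have -> : gl t z - gl s z = (G (y t) z - G (y s) z) - l * (y t z - y s z).
      by rewrite /gl; ring.
    apply: le_trans (ler_normB _ _) _; apply: le_trans (lerD h1 h2) _.
    by rewrite le_eqVlt; apply/orP; left; apply/eqP; rewrite /r; ring.
  apply: (time_unif_mul cE cr) => [s t x s0 t0|].
    have [st|ts] := leP s t; first by apply: le_trans (lip _ _ _ s0 st) (ler_norm _).
    rewrite distrC [leRHS]distrC.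
    exact: le_trans (lip _ _ _ t0 (ltW ts)) (ler_norm _).
  exists (L * B + l * B) => x.
  have -> : gl 0 (b, x) = G y0 (b, x) - l * y0 (b, x).
    by rewrite /gl; have -> : y 0 = y0 by apply/funext.
  apply: le_trans (ler_normB _ _) _; apply: lerD => //.
  by rewrite normrM (ger0_norm l0) ler_wpM2l.
pose c := (2 * M)^-1.
pose rho t x := c * w true t x + c * w false t x.
pose m t x := 2^-1 * w true t x + (- 2^-1) * w false t x.
pose Drho t x := c * Dw true t x + c * Dw false t x.
pose Dm t x := 2^-1 * Dw true t x + (- 2^-1) * Dw false t x.
have c0 : 0 < c by rewrite invr_gt0; lra.
have w_gt0 b t x : 0 <= t -> 0 < w b t x by move=> t0; rewrite mulr_gt0 ?y_gt0.
have rho_gt0 t x : 0 <= t -> 0 < rho t x.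
  by move=> t0; rewrite addr_gt0 // mulr_gt0 ?w_gt0.
have velE t : 0 <= t -> velocity rho m t = vel M (y t).
  move=> t0; apply/funext => x; rewrite /velocity /vel /rho /m /w /c.
  have := y_gt0 t (true, x) t0; have := y_gt0 t (false, x) t0.
  have := E_gt0 t; move: (E t) (y t _) (y t _) => e p q e0 p0 q0.
  by field; rewrite !gt_eqF // addr_gt0 // mulr_gt0.
have DwE b t x : 0 <= t -> Dw b t x = upwind eps (w b t) (velocity rho m t) x.
  by move=> t0; rewrite velE // /Dw glE /upwind /w /=; ring.
have cw b t : 0 <= t -> CT (w b t).
  move=> t0; split => [x|x]; first by rewrite /w (cy b t t0).1.
  by apply: cvgM; [exact: cvg_cst|exact: (cy b t t0).2].
have crho t : 0 <= t -> CT (rho t) by move=> t0; apply: CT_lin; exact: cw.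
have cm t : 0 <= t -> CT (m t) by move=> t0; apply: CT_lin; exact: cw.
have cv t : 0 <= t -> CT (velocity rho m t).
  move=> t0; apply: CT_div; [exact: cm|exact: crho|].
  by move=> x; rewrite gt_eqF // rho_gt0.
have cDw b t : 0 <= t -> CT (Dw b t).
  move=> t0; have -> : Dw b t = upwind eps (w b t) (velocity rho m t).
    by apply/funext => x; exact: DwE.
  by apply: CT_upwind; [exact: cw|exact: cv].
have dlin (a b : R) t x : 0 <= t ->
    is_derive t 1 (fun t => a * w true t x + b * w false t x)
                  (a * Dw true t x + b * Dw false t x).
  move=> t0; apply: is_deriveD.
    exact: (@is_deriveZ R R R _ a t 1 _ (dw true t x t0)).
  exact: (@is_deriveZ R R R _ b t 1 _ (dw false t x t0)).
exists rho, Drho, m, Dm; split.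
- apply: C1_CT_intro => //; first by move=> t t0; apply: CT_lin; exact: cDw.
  by apply: time_unif_lin; exact: uDw.
- apply: C1_CT_intro => //; first by move=> t t0; apply: CT_lin; exact: cDw.
  by apply: time_unif_lin; exact: uDw.
- exact: rho_gt0.
- by move=> t x t0; rewrite upwind_lin /Drho !DwE.
- by move=> t x t0; rewrite upwind_lin /Dm !DwE.
- move=> x; rewrite /rho /w /E mulr0 expR0 !yi /y0 /sg /c /=.
  by field; rewrite gt_eqF.
- move=> x; rewrite /m /w /E mulr0 expR0 !yi /y0 /sg /=.
  by field.
Qed.

End Existence.

(** * Consequences of differentiability in C(T) *)

Section Solutions.
Context {R : realType}.
Implicit Types (s t x h : R) (F DF H : R -> R -> R).

Lemma C1_CT_quotient F DF t : C1_CT F DF -> 0 <= t -> forall e : R, 0 < e ->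
  \forall s \near t, s != t -> 0 <= s ->
    forall x, `|DF t x - (F s x - F t x) / (s - t)| < e.
Proof. by move=> FC t0 e e0; have [_ _ /uniform_cvgP /(_ e e0)] := FC t t0. Qed.

Lemma C1_CT_time_unif F DF : C1_CT F DF -> time_unif F.
Proof.
move=> FC t t0 e e0; have [_ cD _ _] := FC t t0.
have [B B0 hB] := CT_bounded cD.
have d0 : 0 < e / (B + 1) by rewrite divr_gt0 //; lra.
have near_d : \forall s \near t, `|t - s| < e / (B + 1).
  by apply: nbhsx_ballx.
have := C1_CT_quotient FC t0 ltr01; apply: filterS2 near_d => s ts hs s0 x.
have [->|st] := eqVneq s t; first by rewrite subrr normr0.
have st0 : s - t != 0 by rewrite subr_eq0.
have q : `|(F s x - F t x) / (s - t)| <= B + 1.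
  have := hs st s0 x; have := hB x.
  rewrite ler_norml ltr_norml ler_norml => /andP[? ?] /andP[? ?].
  by apply/andP; split; lra.
rewrite distrC -[F s x - F t x](divfK st0) normrM (distrC s) mulrC.
have B1 : 0 < B + 1 by lra.
apply: le_lt_trans (ler_wpM2l (normr_ge0 _) q) _.
by rewrite -ltr_pdivlMr.
Qed.

(** Reflecting time at 0 turns the one-sided notion into continuity on the line. *)
Lemma C1_CT_continuous F DF x : C1_CT F DF -> continuous (fun t => F `|t| x).
Proof.
move=> FC t; apply/cvgrPdist_lt => e e0.
have /nbhs_ballP[d /= d0 hd] := C1_CT_time_unif FC (normr_ge0 t) e0.
apply/nbhs_ballP; exists d => //= s ts; apply: hd => //.
exact: le_lt_trans (ler_dist_dist _ _) ts.
Qed.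

Lemma C1_CT_derive F DF t x : C1_CT F DF -> 0 < t ->
  is_derive t 1 (fun t => F `|t| x) (DF t x).
Proof.
move=> FC t0.
suff c : (fun h : R => h^-1 *: (F `|h *: 1 + t| x - F `|t| x)) @ 0^' --> DF t x.
  by apply: DeriveDef; [exact: cvgP c|exact: cvg_lim c].
apply/cvgrPdist_lt => e e0.
have /nbhs_ballP[d /= d0 hd] := C1_CT_quotient FC (ltW t0) e0.
have m0 : 0 < Num.min d t by rewrite lt_min d0.
apply/nbhs_ballP; exists (Num.min d t) => // h.
rewrite /ball /= sub0r normrN lt_min => /andP[hd1 ht] h0.
have := hd (h + t); rewrite /ball /= opprD addrCA subrr addr0 normrN.
move=> /(_ hd1); rewrite -subr_eq0 addrK => /(_ h0).
have ht0 : 0 <= h + t by move: ht; rewrite ltr_norml => /andP[]; lra.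
move=> /(_ ht0 x); rewrite /GRing.scale /= mulr1 (ger0_norm ht0) (gtr0_norm t0).
by rewrite mulrC.
Qed.

(** Integration is a bounded linear form on C(T), hence commutes with the time
    derivative. Real numbers are encoded as constant functions on the torus. *)
Lemma C1_CT_itg F DF : C1_CT F DF ->
  C1_CT (fun t _ => itg 0 (pi *+ 2) (F t)) (fun t _ => itg 0 (pi *+ 2) (DF t)).
Proof.
move=> FC t t0.
have cst_CT (k : R) : CT (fun=> k) by split => // ?; exact: cvg_cst.
have [cF cD] : continuous (F t) /\ continuous (DF t) by have [[] ? ? []] := FC t t0.
have T0 := ltW (@twopi_gt0 R).
have small (f : R -> R) (d : R) : continuous f -> (forall x, `|f x| <= d) ->
    `|itg 0 (pi *+ 2) f| <= d * (pi *+ 2).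
  move=> cf hf; apply: le_trans (itg_norm _ _ cf) _.
  rewrite -[X in d * X]subr0 -itg_cst //; apply: itg_le => //.
    by move=> x; apply: cvg_norm; exact: cf.
  by move=> x; exact: cvg_cst.
have d0 (e : R) : 0 < e -> 0 < e / (pi *+ 2 + 1).
  by move=> e0; rewrite divr_gt0 // ltr_wpDl.
have de (e : R) : 0 < e -> e / (pi *+ 2 + 1) * (pi *+ 2) < e.
  move=> e0; rewrite mulrAC ltr_pdivrMr ?ltr_wpDl // ltr_pM2l //.
  by rewrite ltrDl.
split => //.
- apply/uniform_cvgP => e e0.
  suff : nbhs t (fun s => s != t -> 0 <= s -> forall x, `|itg 0 (pi *+ 2) (DF t) -
    (itg 0 (pi *+ 2) (F s) - itg 0 (pi *+ 2) (F t)) / (s - t)| < e) by [].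
  have := C1_CT_quotient FC t0 (d0 e e0); apply: filterS => s hs st s0 _.
  have cFs : continuous (F s) by have [[]] := FC s s0.
  rewrite -itgB // [_ / _]mulrC -itgZ; last by move=> x; apply: cvgB; [exact: cFs|exact: cF].
  have cq : continuous (fun x => (s - t)^-1 * (F s - F t) x).
    by move=> x; apply: cvgM; [exact: cvg_cst|apply: cvgB; [exact: cFs|exact: cF]].
  rewrite -itgB //.
  apply: le_lt_trans (small _ (e / (pi *+ 2 + 1)) _ _) (de e e0).
    by move=> x; apply: cvgB; [exact: cD|exact: cq].
  by move=> x; apply: ltW; have := hs st s0 x; rewrite !fctE [_^-1 * _]mulrC.
- apply/uniform_cvgP => e e0.
  have [_ _ _ /uniform_cvgP /(_ _ (d0 e e0))] := FC t t0.
  suff : (nbhs t (fun s => 0 <= s -> forall x, `|DF t x - DF s x| < e / (pi *+ 2 + 1)) ->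
    nbhs t (fun s => 0 <= s -> forall x : R, `|itg 0 (pi *+ 2) (DF t) -
      itg 0 (pi *+ 2) (DF s)| < e)) by [].
  apply: filterS => s hs s0 _.
  have cDs : continuous (DF s) by have [_ []] := FC s s0.
  rewrite -itgB //.
  apply: le_lt_trans (small _ (e / (pi *+ 2 + 1)) _ _) (de e e0).
    by move=> x; apply: cvgB; [exact: cD|exact: cDs].
  by move=> x; apply: ltW; exact: hs.
Qed.

End Solutions.

(** * Uniform estimates on solutions *)

Section Estimates.
Context {R : realType}.
Implicit Types (s t x h : R).

Section Solution.
Variables (eps : R) (rho0 u0 : R -> R) (rho Drho m Dm : R -> R -> R).
Hypothesis eps0 : 0 < eps.
Hypothesis sol : ode_solution eps rho0 u0 rho Drho m Dm.

(** Invariance of the cone |m| <= M rho with M = M0 + 1. As long as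
    D+ = M rho + m and D- = M rho - m are nonnegative, |u| <= M, hence
    e^(M t / eps) D+ and e^(M t / eps) D- do not decrease and D+, D- are at least
    d e^(- M t / eps). This margin, uniform in x, lets the induction proceed
    beyond T. It is positive because M exceeds M0 by 1, so that D+ and D- are at
    least rho0 at time 0. *)
Lemma momentum_le (M0 d : R) : 0 < d -> (forall x, d <= rho0 x) ->
  (forall x, `|u0 x| <= M0) ->
  forall t x, 0 <= t -> `|m t x| <= (M0 + 1) * rho t x.
Proof.
move=> d0 rho0d uM0; pose M := M0 + 1.
have M00 : 0 <= M0 by exact: le_trans (normr_ge0 _) (uM0 0).
pose sg (a : bool) : R := if a then 1 else -1.
pose D a t x := M * rho t x + sg a * m t x.
have [Crho Cm] := (ode_rho_C1 sol, ode_m_C1 sol).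
pose lam := M / eps.
have DD a t x : 0 < t -> is_derive t 1 (fun t => D a `|t| x)
    (upwind eps (D a t) (velocity rho m t) x).
  move=> t0; rewrite upwind_lin -(ode_rho_eq sol x (ltW t0)) -(ode_m_eq sol x (ltW t0)).
  apply: is_deriveD.
    exact: (@is_deriveZ R R R _ M t 1 _ (C1_CT_derive x Crho t0)).
  exact: (@is_deriveZ R R R _ (sg a) t 1 _ (C1_CT_derive x Cm t0)).
have cD a x : continuous (fun t => D a `|t| x).
  apply: continuous_fD; apply: continuous_fM; try (move=> ?; exact: cvg_cst).
    exact: C1_CT_continuous Crho.
  exact: C1_CT_continuous Cm.
have uD a : time_unif (D a).
  by apply: time_unif_lin; [exact: C1_CT_time_unif Crho|exact: C1_CT_time_unif Cm].
have D0 a x : d <= D a 0 x.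
  rewrite /D (ode_rho_init sol) (ode_m_init sol).
  have -> : M * rho0 x + sg a * (rho0 x * u0 x) = rho0 x * (M + sg a * u0 x) by ring.
  rewrite -[d]mulr1; apply: ler_pM => //; first exact: ltW.
  by rewrite /sg; have := uM0 x; rewrite ler_norml /M => /andP[? ?]; case: a; lra.
have velM t : 0 <= t -> (forall a x, 0 <= D a t x) ->
    forall x, `|velocity rho m t x| <= M.
  move=> t0 Dt x; have r0 := ode_rho_gt0 sol x t0.
  rewrite /velocity normrM normfV (gtr0_norm r0) ler_pdivrMr // ler_norml.
  by have := Dt true x; have := Dt false x; rewrite /D /sg => ? ?; apply/andP; split; lra.
have pos : forall t, 0 <= t -> exists2 c, 0 < c & forall a x, c <= D a t x.
  apply: real_induction => T T0.
    move=> below; exists (expR (- (lam * T)) * d); first by rewrite mulr_gt0 ?expR_gt0.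
    move=> a x.
    pose E t := expR (lam * t).
    have dE t : is_derive t 1 E (lam * E t) by exact: is_derive_expR_lin.
    have := @derive_le_increment _ (cst 0) (fun t => E t * D a `|t| x) (cst 0)
      (fun t => E t * (lam * D a t x + upwind eps (D a t) (velocity rho m t) x)) 0 T T0.
    rewrite /= subrr !normr0 (ger0_norm T0) /E mulr0 expR0 mul1r => H.
    rewrite expRN mulrC ler_pdivrMr ?expR_gt0 // [leRHS]mulrC.
    apply: le_trans (D0 a x) _; rewrite -subr_ge0; apply: H.
    - by move=> ?; exact: cvg_cst.
    - by apply: continuous_fM => //; exact: is_derive_continuous dE.
    - move=> t /andP[t0 tT].
      have := @is_deriveM R R E (fun t => D a `|t| x) t 1 _ _ (dE t) (DD a t x t0).
      rewrite /GRing.scale /= (gtr0_norm t0) => h.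
      have -> : expR (lam * t) * (lam * D a t x + upwind eps (D a t) (velocity rho m t) x) =
        E t * upwind eps (D a t) (velocity rho m t) x + D a t x * (lam * E t).
        by rewrite /E; ring.
      exact: h.
    - move=> t /andP[t0 tT].
      have Dt a' x' : 0 <= D a' t x'.
        have [c c0 hc] : exists2 c, 0 < c & forall a x, c <= D a t x.
          by apply: below; rewrite ltW.
        exact: le_trans (ltW c0) (hc _ _).
      rewrite mulr_ge0 ?expR_ge0 //; apply: upwind_ge => //.
      by apply: velM => //; exact: ltW.
  move=> [c c0 hc]; have c2 : 0 < c / 2 by lra.
  apply: filterS2 (uD true T T0 _ c2) (uD false T T0 _ c2) => s h1 h2 s0.
  exists (c / 2) => // a x.
  have : `|D a T x - D a s x| < c / 2 by case: a; [exact: h1|exact: h2].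
  by have := hc a x; rewrite ltr_norml => ? /andP[? ?]; lra.
move=> t x t0; have [c c0 hc] := pos t t0.
have := hc true x; have := hc false x; rewrite /D /sg /M ler_norml => ? ?.
by apply/andP; split; lra.
Qed.

Lemma CT_velocity t : 0 <= t -> CT (velocity rho m t).
Proof.
move=> t0; apply: CT_div.
- by have [] := ode_m_C1 sol t0.
- by have [] := ode_rho_C1 sol t0.
- by move=> x; rewrite gt_eqF // (ode_rho_gt0 sol).
Qed.

Lemma mass_conservation t : 0 <= t ->
  itg 0 (pi *+ 2) (rho t) = itg 0 (pi *+ 2) rho0.
Proof.
move=> t0.
have CI := C1_CT_itg (ode_rho_C1 sol).
have := @normr_derive_le_increment _ (fun t => itg 0 (pi *+ 2) (rho `|t|)) (cst 0)
  (fun t => itg 0 (pi *+ 2) (Drho t)) (cst 0) 0 t t0.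
rewrite /= subrr normr0 (ger0_norm t0) => H.
have -> : rho0 = rho 0 by apply/funext => x; rewrite (ode_rho_init sol).
apply/eqP; rewrite -subr_eq0 -normr_le0; apply: H.
- exact: (@C1_CT_continuous _ _ _ 0 CI).
- by move=> ?; exact: cvg_cst.
- by move=> s /andP[s0 _]; exact: (@C1_CT_derive _ _ _ s 0 CI s0).
- move=> s /andP[s0 _].
  have -> : Drho s = upwind eps (rho s) (velocity rho m s).
    by apply/funext => x; rewrite (ode_rho_eq sol) // ltW.
  rewrite itg_upwind ?normr0 //.
    by have [] := ode_rho_C1 sol (ltW s0).
  exact: CT_velocity (ltW s0).
Qed.

End Solution.

(** Summation by parts moves the difference quotients onto the test function,
    where they agree with its derivative up to B eps. The support of psi keeps
    a distance 1 >= eps from the ends of [- a, a], hence no boundary term appears. *)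
Lemma upwind_weak_estimate (psi dpsi : R -> R) (a B k eps : R) (w u rho : R -> R) :
  0 < eps <= 1 -> 0 <= a ->
  (forall x, is_derive x 1 psi (dpsi x)) -> continuous dpsi ->
  (forall x, a < `|x| + 1 -> psi x = 0 /\ dpsi x = 0) ->
  (forall x h, `|psi (x + h) - psi x - h * dpsi x| <= B * h ^+ 2) ->
  CT w -> CT u -> continuous rho -> 0 <= B ->
  (forall x, `|w x * u x| <= k * rho x) ->
  `|(\int[lebesgue_measure]_x (upwind eps w u x * psi x - w x * u x * dpsi x))%R|
    <= eps * (B * k * itg (- a) a rho).
Proof.
move=> /andP[eps0 eps1] a0 dpsiE cdpsi supp taylor cTw cTu crho B0 wu.
have [cw cu] := (cTw.2, cTu.2).
have cpsi : continuous psi by exact: is_derive_continuous dpsiE.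
pose P : R -> R := w \* u^\+; pose N : R -> R := w \* u^\-.
have cP : continuous P by exact: continuous_wpos.
have cN : continuous N by exact: continuous_wneg.
have far x : ~ (- a <= x <= a) -> a < `|x|.
  by move=> h; rewrite ltNge; apply/negP; rewrite ler_norml.
have aN : - a <= a by lra.
have ccst (c : R) : continuous (fun _ : R => c) by move=> ?; exact: cvg_cst.
have csh (f : R -> R) h : continuous f -> continuous (fun x => f (x + h)).
  by move=> cf; exact: continuous_translation.
(* Both integrals are the integral over the line of f x * psi (x - h). *)
have trans (f : R -> R) h : continuous f -> `|h| <= 1 ->
    itg (- a) a (fun x => f (x + h) * psi x) = itg (- a) a (fun x => f x * psi (x - h)).
  move=> cf h1; pose g x := f x * psi (x - h).
  have cg : continuous g by apply: continuous_fM => //; exact: csh.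
  have -> : (fun x => f (x + h) * psi x) = (fun x => g (x + h)).
    by apply/funext => x; rewrite /g addrK.
  rewrite itg_shift //.
  transitivity (\int[lebesgue_measure]_x g x)%R; last first.
    apply: itg_supp => x /far xa; rewrite /g (supp _ _).1 ?mulr0 //.
    have : `|x| <= `|x - h| + `|h| by rewrite -{1}(subrK h x) ler_normD.
    lra.
  apply/esym/itg_supp => x xa; rewrite /g (supp _ _).1 ?mulr0 //.
  have : a < `|x - h|; last lra.
  by apply: far => /andP[? ?]; apply: xa; apply/andP; split; lra.
rewrite (@itg_supp _ _ (- a) a); last first.
  move=> x /far xa; have [] := supp x; first lra.
  by move=> -> ->; rewrite !mulr0 subrr.
pose rP x := eps^-1 * (psi (x + eps) - psi x - eps * dpsi x).
pose rN x := eps^-1 * (psi (x - eps) - psi x - (- eps) * dpsi x).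
have crP : continuous rP.
  apply: continuous_fM => //; apply: continuous_fB; last exact: continuous_fM.
  by apply: continuous_fB => //; exact: csh.
have crN : continuous rN.
  apply: continuous_fM => //; apply: continuous_fB; last exact: continuous_fM.
  by apply: continuous_fB => //; exact: csh.
have e1 : `|eps| <= 1 by rewrite gtr0_norm.
have e1' : `|- eps| <= 1 by rewrite normrN.
have E : itg (- a) a (fun x => upwind eps w u x * psi x - w x * u x * dpsi x) =
    itg (- a) a (fun x => P x * rP x + N x * rN x).
  pose rest x := - (eps^-1 * ((P x + N x) * psi x)) - (P x - N x) * dpsi x.
  have crest : continuous rest.
    apply: continuous_fB; last first.
      by apply: continuous_fM => //; exact: continuous_fB.
    apply: continuous_fN; apply: continuous_fM => //.
    by apply: continuous_fM => //; exact: continuous_fD.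
  have split3 (F G H : R -> R) : continuous F -> continuous G -> continuous H ->
      itg (- a) a (fun x => eps^-1 * F x + eps^-1 * G x + H x) =
      eps^-1 * itg (- a) a F + eps^-1 * itg (- a) a G + itg (- a) a H.
    move=> cF cG cH.
    have c1 : continuous (fun x => eps^-1 * F x) by exact: continuous_fM.
    have c2 : continuous (fun x => eps^-1 * G x) by exact: continuous_fM.
    rewrite -!itgZ // -itgD // -itgD //; exact: continuous_fD.
  transitivity (itg (- a) a (fun x => eps^-1 * (P (x - eps) * psi x) +
      eps^-1 * (N (x + eps) * psi x) + rest x)).
    congr itg; apply/funext => x; rewrite upwindE /rest -/P -/N.
    have -> : w x * u x = P x - N x.
      rewrite /P /N /= /funrpos /funrneg -mulrBr; congr (_ * _).
      by rewrite !max0E normrN; field.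
    ring.
  transitivity (itg (- a) a (fun x => eps^-1 * (P x * psi (x + eps)) +
      eps^-1 * (N x * psi (x - eps)) + rest x)); last first.
    congr itg; apply/funext => x; rewrite /rest /rP /rN.
    by field; rewrite gt_eqF.
  rewrite !split3 //; try by apply: continuous_fM => //; exact: csh.
  rewrite (trans _ (- eps)) // (trans _ eps) //.
  by rewrite opprK.
rewrite E.
have cPN : continuous (fun x => P x * rP x + N x * rN x).
  by apply: continuous_fD; exact: continuous_fM.
apply: le_trans (itg_norm _ _ cPN) _.
rewrite mulrA -itgZ //; apply: itg_le.
- by move=> x; apply: cvg_norm; exact: cPN.
- exact: continuous_fM.
move=> x _.
have bound h : h ^+ 2 = eps ^+ 2 ->
    `|eps^-1 * (psi (x + h) - psi x - h * dpsi x)| <= eps * B.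
  move=> h2; rewrite normrM gtr0_norm ?invr_gt0 // mulrC ler_pdivrMr //.
  by apply: le_trans (taylor x h) _; rewrite h2 le_eqVlt; apply/orP; left; apply/eqP; ring.
have bP : `|rP x| <= eps * B by exact: bound.
have bN : `|rN x| <= eps * B by apply: bound => //; rewrite sqrrN.
apply: le_trans (ler_normD _ _) _; rewrite (normrM (P x)) (normrM (N x)).
have PN : `|P x| + `|N x| = `|w x * u x|.
  have max0 (v : R) : `|Num.max v 0| = Num.max v 0 by rewrite ger0_norm // le_max lexx orbT.
  rewrite /P /N /= /funrpos /funrneg !normrM !max0 -mulrDr; congr (_ * _).
  exact: max_split.
have := ler_wpM2l (normr_ge0 (P x)) bP; have := ler_wpM2l (normr_ge0 (N x)) bN.
have := ler_wpM2l (mulr_ge0 (ltW eps0) B0) (wu x); rewrite -PN.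
have -> : eps * B * (k * rho x) = eps * (B * k) * rho x by ring.
lra.
Qed.

End Estimates.

(** * Test functions *)

Section TestFunctions.
Context {R : realType}.
Implicit Types (psi f df : R -> R) (x h : R).

(** B bounds the second derivative, which is continuous and, like psi and its
    derivative, vanishes outside [- A, A]. *)
Lemma test_function_bounds psi : test_function psi ->
  exists A B : R, [/\ 0 <= A, 0 <= B,
    forall x, is_derive x 1 psi (psi^`()%classic x),
    continuous (psi^`()%classic) &
    (forall x, A < `|x| -> psi x = 0 /\ psi^`()%classic x = 0) /\
    (forall x h, `|psi (x + h) - psi x - h * psi^`()%classic x| <= B * h ^+ 2)].
Proof.
move=> [dpsi cpt].
have dn n x : is_derive x 1 (psi^`(n)%classic) (psi^`(n.+1)%classic x).
  by rewrite derive1nS derive1E; apply/derivableP; exact: dpsi.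
have d0 x : is_derive x 1 psi (psi^`()%classic x) by have := dn 0%N x; rewrite derive1n1.
have d1 x : is_derive x 1 (psi^`()%classic) (psi^`(2)%classic x).
  by have := dn 1%N x; rewrite derive1n1.
have c1 : continuous (psi^`()%classic) by exact: is_derive_continuous d1.
have c2 : continuous (psi^`(2)%classic) by exact: is_derive_continuous (dn 2%N).
have [A A0 hA] : exists2 A, 0 <= A & forall x, A < `|x| -> psi x = 0.
  have [M [Mr hM]] := compact_bounded cpt.
  exists (`|M| + 1) => [|x Mx]; first by rewrite addr_ge0.
  apply/eqP; apply: contraTT Mx => px; rewrite -leNgt.
  apply: hM; first by rewrite (le_lt_trans (ler_norm M)) // ltrDl.
  exact: subset_closure.
have out f df : (forall x, A < `|x| -> f x = 0) ->
    (forall x, is_derive x 1 f (df x)) -> forall x, A < `|x| -> df x = 0.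
  move=> f0 dfE x Ax.
  have n0 : \near x, cst 0 x = f x.
    have /nbhs_ballP[d /= dgt hd] : \forall y \near x, A < `|y|.
      have : (fun y : R => `|y|) @ x --> `|x| by exact: norm_continuous.
      by move=> /cvgr_gt; apply.
    by apply/nbhs_ballP; exists d => // y xy; rewrite f0 //; exact: hd.
  have h0 : is_derive x (1 : R) f 0 by apply: near_eq_is_derive n0 _.
  have E0 : 'D_1 f x = 0 by exact: derive_val.
  by rewrite -E0; apply/esym; have := dfE x => ?; exact: derive_val.
have hA1 := out _ _ hA d0; have hA2 := out _ _ hA1 d1.
have [B B0 hB] := continuous_bounded (- A) A c2.
exists A, B; split => //; split; first by move=> x Ax; split; [exact: hA|exact: hA1].
apply: (taylor1 d0 d1) => x.
have [xA|Ax] := leP `|x| A; first by apply: hB; rewrite -ler_norml.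
by rewrite hA2 // normr0.
Qed.

End TestFunctions.

(** * Bounds on the initial data *)

Section TorusMeasure.
Context {R : realType}.
Implicit Types (f g : R -> R) (c x : R).
Local Notation mu := (@torus_measure R).

Lemma torus_measureE (A : set R) : mu A = lebesgue_measure (A `&` `[0, pi *+ 2[).
Proof. by []. Qed.

Lemma torus_measureT_gt0 : (0 < mu [set: R])%E.
Proof.
rewrite torus_measureE setTI lebesgue_measure_itv /= lte_fin twopi_gt0.
by rewrite sube0 lte_fin twopi_gt0.
Qed.

(** If |f| > c at some point, then |f| > c on an open interval of the fundamental
    domain, which has positive measure. *)
Lemma ae_torus_le f c : CT f -> {ae mu, forall x, `|f x| <= c} ->
  forall x, `|f x| <= c.
Proof.
move=> [pf cf] [N [mN N0 hN]] x.
have [y /andP[y0 yT] hy] := periodic_reduce twopi_gt0 pf x.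
have := hy 0; rewrite !addr0 => ->; rewrite leNgt; apply/negP => cy.
have /nbhs_ballP[d /= d0 hd] : \forall z \near y, c < `|f z|.
  have : (fun z : R => `|f z|) @ y --> `|f y| by apply: cvg_norm; exact: cf.
  by move=> /cvgr_gt; apply.
pose l := Num.max 0 (y - d); pose r := Num.min (pi *+ 2) (y + d).
have T0 := @twopi_gt0 R.
have lr : l < r.
  by rewrite /l /r gt_max !lt_min; apply/andP; split; apply/andP; split; lra.
have IN : `]l, r[ `<=` N.
  move=> z; rewrite /= in_itv /= /l /r gt_max lt_min.
  move=> /andP[/andP[z0 yz] /andP[zT zy]]; apply: hN => /= zc.
  have : c < `|f z| by apply: hd; rewrite /ball /= ltr_norml; apply/andP; split; lra.
  by rewrite ltNge zc.
have : (mu `]l, r[ <= mu N)%E by apply: le_measure => //; rewrite inE.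
rewrite N0 torus_measureE setIidl; last first.
  move=> z; rewrite /= !in_itv /= /l /r gt_max lt_min.
  by move=> /andP[/andP[z0 _] /andP[zT _]]; rewrite ltW.
rewrite lebesgue_measure_itv /= lte_fin lr -EFinD lee_fin; lra.
Qed.

Lemma cvg_right0_lt1 (N : R -> \bar R) : N eps @[eps --> (0 : R)^'+] --> 0%E ->
  \forall eps \near (0 : R)^'+, (N eps < 1)%E.
Proof.
move=> cN; apply: (cN [set z | (z < 1)%E]).
by apply: open_nbhs_nbhs; split; [exact: open_ereal_lt_ereal|rewrite /= lte01].
Qed.

Lemma near_right0_itv : \forall eps \near (0 : R)^'+, 0 < eps <= 1.
Proof.
have e1 : \forall eps \near (0 : R)^'+, eps <= 1 by apply: nbhs_right_le.
near=> eps; apply/andP; split; last by near: eps.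
by near: eps; exact: nbhs_right_gt.
Unshelve. all: by end_near. Qed.

Lemma Linfty_near_bounded (f : R -> R) (fe : R -> R -> R) :
  f \in Lfun mu +oo%E -> (forall eps : R, 0 < eps <= 1 -> CT (fe eps)) ->
  'N[mu]_+oo[(fun x => (fe eps x - f x)%:E)]%E @[eps --> (0 : R)^'+] --> 0%E ->
  exists M, \forall eps \near (0 : R)^'+, forall x, `|fe eps x| <= M.
Proof.
move=> fL cfe /cvg_right0_lt1 N1.
have fin : ('N[mu]_+oo[EFin \o f] < +oo)%E.
  by have := sub_Lfun_finLfun fL; rewrite inE.
move: fin; rewrite unlock torus_measureT_gt0.
move E : (ess_sup mu _) => s sfin.
have [M sM] : exists M : R, (s <= M%:E)%E.
  by move: s sfin {E} => [r _|//|_]; [exists r|exists 0; rewrite leNye].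
exists (M + 1).
apply: filterS2 N1 near_right0_itv => eps; rewrite unlock torus_measureT_gt0 => h eps01.
apply: ae_torus_le; first exact: cfe.
have h1 := ess_sup_ge mu (abse \o (EFin \o f)).
have h2 := ess_sup_ge mu (abse \o (fun x => (fe eps x - f x)%:E)).
rewrite E in h1.
apply: filterS2 h1 h2 => x /= /le_trans /(_ sM); rewrite lee_fin => fM hx.
have : `|fe eps x - f x| <= 1 by rewrite -lee_fin (le_trans hx) // ltW.
move: fM; rewrite !ler_norml => /andP[? ?] /andP[? ?].
by apply/andP; split; lra.
Qed.

Lemma itg_le_torus f : CT f -> ((itg 0 (pi *+ 2) f)%:E <= \int[mu]_x `|(f x)%:E|)%E.
Proof.
move=> [_ cf].
have cnf : continuous (fun x => `|f x|) by move=> x; apply: cvg_norm; exact: cf.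
have mnf : measurable_fun [set: R] (fun x => `|f x| : R).
  exact: continuous_measurable_fun.
move/measurable_EFinP in mnf.
have mD : measurable (`[0, pi *+ 2[ : set R) by exact: measurable_itv.
apply: (@le_trans _ _ (\int[mu]_(x in `[0%R, (pi *+ 2)%R[) `|(f x)%:E|)%E); last first.
  by apply: ge0_subset_integral.
rewrite (@eq_measure_integral _ _ _ _ lebesgue_measure); last first.
  by move=> A mA AD; rewrite [LHS]torus_measureE setIidl.
rewrite integral_itv_bndo_bndc; last exact: measurable_funTS.
have i1 := itg_integrable 0 (pi *+ 2) cnf.
rewrite -[leRHS]fineK; last exact: integrable_fin_num i1.
rewrite lee_fin; apply: le_trans (ler_norm _) _; exact: itg_norm.
Qed.

Lemma L1_near_bounded (f : R -> R) (fe : R -> R -> R) :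
  f \in Lfun mu 1%E -> (forall eps : R, 0 < eps <= 1 -> CT (fe eps)) ->
  'N[mu]_1[(fun x => (f x - fe eps x)%:E)]%E @[eps --> (0 : R)^'+] --> 0%E ->
  exists2 M, 0 <= M & \forall eps \near (0 : R)^'+, itg 0 (pi *+ 2) (fe eps) <= M.
Proof.
move=> fL cfe /cvg_right0_lt1 N1.
have mf : measurable_fun [set: R] f by have := sub_Lfun_mfun fL; rewrite inE.
have fin : ('N[mu]_1[EFin \o f] < +oo)%E.
  by have := sub_Lfun_finLfun fL; rewrite inE.
have n0 := Lnorm_ge0 mu 1 (EFin \o f).
pose M := fine ('N[mu]_1[EFin \o f])%E.
have M0 : 0 <= M by rewrite fine_ge0.
have ME : ('N[mu]_1[EFin \o f])%E = M%:E by rewrite fineK // ge0_fin_numE.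
exists (M + 1); first by rewrite addr_ge0.
apply: filterS2 N1 near_right0_itv => eps; rewrite Lnorm1 => h eps01.
have mfe : measurable_fun [set: R] (fe eps).
  by apply: continuous_measurable_fun; have [] := cfe _ eps01.
rewrite -lee_fin; apply: le_trans (itg_le_torus (cfe _ eps01)) _.
apply: (@le_trans _ _ (\int[mu]_x (`|(f x)%:E| + `|(f x - fe eps x)%:E|))%E).
  apply: ge0_le_integral => //.
  - by apply/measurable_EFinP; exact: measurableT_comp.
  - apply: emeasurable_funD; apply/measurable_EFinP.
      exact: measurableT_comp.
    by apply: measurableT_comp => //; exact: measurable_funB.
  - move=> x _; rewrite /= -EFinD lee_fin.
    by rewrite -{1}(subKr (f x) (fe eps x)) ler_normB.
rewrite ge0_integralD //; last 2 first.
- by apply/measurable_EFinP; exact: measurableT_comp.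
- apply/measurable_EFinP; apply: measurableT_comp => //; exact: measurable_funB.
rewrite EFinD; apply: leeD; last exact: ltW.
by rewrite -ME Lnorm1.
Qed.

End TorusMeasure.

(** * The weak asymptotic method *)

Section WeakAsymptotic.
Context {R : realType}.

(** The support of psi is covered by 2 n periods, so that rho, which dominates the
    flux, has mass at most 2 n Q on it. *)
Lemma weak_asymptotic_upwind (Dw flux w u rho : R -> R -> R -> R) (K Q : R) :
  0 <= K -> 0 <= Q ->
  (\forall eps \near (0 : R)^'+, forall t, 0 <= t ->
     [/\ CT (w eps t), CT (u eps t) & CT (rho eps t)] /\
     [/\ Dw eps t =1 upwind eps (w eps t) (u eps t),
         forall x, flux eps t x = w eps t x * u eps t x,
         forall x, `|w eps t x * u eps t x| <= K * rho eps t x &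
         itg 0 (pi *+ 2) (rho eps t) <= Q]) ->
  weak_asymptotic_order1 Dw flux.
Proof.
move=> K0 Q0 H psi tpsi t t0.
have [A [B [A0 B0 d0 c1 [supp taylor]]]] := test_function_bounds tpsi.
pose n := (Num.truncn (A + 1)).+1.
pose a : R := pi *+ 2 *+ n.
have pi2 : 1 <= pi *+ 2 :> R by have := pi_ge2 R; rewrite mulr2n; lra.
have aA : A + 1 < a.
  apply: lt_le_trans (truncnS_gt _) _; rewrite -/n /a -[leRHS]mulr_natr.
  by rewrite ler_peMl.
apply/eqO_exP; exists (B * K * (Q *+ (n + n)) + 1).
  by rewrite ltr_wpDl // !mulr_ge0 // mulrn_wge0.
apply: filterS2 H (@near_right0_itv R) => eps /(_ t t0).
move=> [[cw cu crho] [DwE fluxE wu mass]] eps01.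
have /andP[eps0 _] := eps01.
have -> : (fun x => Dw eps t x * psi x - flux eps t x * psi^`()%classic x) =
    (fun x => upwind eps (w eps t) (u eps t) x * psi x -
              w eps t x * u eps t x * psi^`()%classic x).
  by apply/funext => x; rewrite DwE fluxE.
rewrite [`|eps|]gtr0_norm //.
apply: (@le_trans _ _ (eps * (B * K * itg (- a) a (rho eps t)))).
  apply: (upwind_weak_estimate (a := a)) => //.
  - by rewrite mulrn_wge0 // ltW // twopi_gt0.
  - by move=> x ax; apply: supp; lra.
  - exact: crho.2.
rewrite mulrC; apply: ler_wpM2r; first exact: ltW.
rewrite (itg_periods _ (ltW twopi_gt0) crho.2 crho.1).
have h1 : itg 0 (pi *+ 2) (rho eps t) *+ (n + n) <= Q *+ (n + n).
  by rewrite lerMn2r mass orbT.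
have := ler_wpM2l (mulr_ge0 B0 K0) h1; lra.
Qed.

End WeakAsymptotic.

Unset Implicit Arguments.
Set Strict Implicit.

Theorem theorem1 (R : realType) (rho0 u0 : R -> R) (rho0e u0e : R -> R -> R)
  (rho0_L1 : LpT 1%E rho0)
  (rho0_ge0 : {ae @torus_measure R, forall x, 0 <= rho0 x})
  (u0_Loo : LpT +oo%E u0)
  (rho0e_C : forall eps : R, 0 < eps <= 1 -> CT (rho0e eps))
  (u0e_C : forall eps : R, 0 < eps <= 1 -> CT (u0e eps))
  (rho0e_ge : forall (eps : R) (x : R), 0 < eps <= 1 -> eps <= rho0e eps x)
  (rho0e_cvg : 'N[@torus_measure R]_1[(fun x => (rho0 x - rho0e eps x)%:E)]%E
                 @[eps --> (0 : R)^'+] --> 0%E)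
  (u0e_cvg : 'N[@torus_measure R]_+oo[(fun x => (u0e eps x - u0 x)%:E)]%E
                 @[eps --> (0 : R)^'+] --> 0%E) :
  (forall eps : R, 0 < eps <= 1 -> exists rho Drho m Dm : R -> R -> R,
     ode_solution eps (rho0e eps) (u0e eps) rho Drho m Dm) /\
  (forall rho Drho m Dm : R -> R -> R -> R,
     (forall eps : R, 0 < eps <= 1 ->
        ode_solution eps (rho0e eps) (u0e eps)
          (rho eps) (Drho eps) (m eps) (Dm eps)) ->
     weak_asymptotic_order1 Drho m /\
     weak_asymptotic_order1 Dm
       (fun eps t x => rho eps t x * velocity (rho eps) (m eps) t x ^+ 2)).
Proof.
split=> [eps eps01|rho Drho m Dm sol].
  have /andP[eps0 _] := eps01.
  apply: ode_exists => //; [exact: rho0e_C|exact: u0e_C|].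
  by move=> x; apply: lt_le_trans eps0 _; exact: rho0e_ge.
have [M hM] := Linfty_near_bounded u0_Loo.2 u0e_C u0e_cvg.
have [Q Q0 hQ] := L1_near_bounded rho0_L1.2 rho0e_C rho0e_cvg.
pose K := `|M| + 1.
have K0 : 0 <= K by rewrite addr_ge0.
have bounds : \forall eps \near (0 : R)^'+, 0 < eps <= 1 /\ forall t, 0 <= t ->
    itg 0 (pi *+ 2) (rho eps t) <= Q /\
    forall x, [/\ 0 < rho eps t x, `|m eps t x| <= K * rho eps t x &
                  `|velocity (rho eps) (m eps) t x| <= K].
  apply: filterS3 hM hQ (@near_right0_itv R) => eps uM rQ eps01.
  split=> // t t0; have s := sol eps eps01; have /andP[eps0 _] := eps01.
  rewrite (mass_conservation s t0); split=> // x.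
  have r0 := ode_rho_gt0 s x t0.
  have mK : `|m eps t x| <= K * rho eps t x.
    apply: (momentum_le eps0 s eps0) => // [y|y]; first exact: rho0e_ge.
    exact: le_trans (uM y) (ler_norm M).
  by split=> //; rewrite /velocity normrM normfV (gtr0_norm r0) ler_pdivrMr.
have regular eps t : 0 < eps <= 1 -> 0 <= t ->
    [/\ CT (rho eps t), CT (m eps t) & CT (velocity (rho eps) (m eps) t)].
  move=> eps01 t0; have s := sol eps eps01.
  have [? _ _ _] := ode_rho_C1 s t0; have [? _ _ _] := ode_m_C1 s t0.
  by split=> //; exact: CT_velocity s t t0.
split.
- apply: (weak_asymptotic_upwind (w := rho) (rho := rho)
    (u := fun eps => velocity (rho eps) (m eps)) K0 Q0).
  apply: filterS bounds => eps [eps01 h] t t0; have [mass pw] := h t t0.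
  have [crho _ cv] := regular eps t eps01 t0.
  have wu x : rho eps t x * velocity (rho eps) (m eps) t x = m eps t x.
    by have [r0 _ _] := pw x; rewrite mulrC divfK // gt_eqF.
  split=> //; split=> // x; first exact: ode_rho_eq (sol _ eps01) _ _ t0.
  by rewrite wu; have [] := pw x.
- apply: (weak_asymptotic_upwind (w := m) (rho := rho)
    (u := fun eps => velocity (rho eps) (m eps)) (mulr_ge0 K0 K0) Q0).
  apply: filterS bounds => eps [eps01 h] t t0; have [mass pw] := h t t0.
  have [crho cm cv] := regular eps t eps01 t0.
  split=> //; split=> // x; first exact: ode_m_eq (sol _ eps01) _ _ t0.
    by have [r0 _ _] := pw x; rewrite /velocity; field; rewrite gt_eqF.
  have [r0 mK vK] := pw x.
  by rewrite normrM mulrAC; exact: ler_pM.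
Qed.
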